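(* Let $\mathbb k$ be a field and $r>0$ a real number. Then $\mathcal B_{\le r}$ is a Frobenius category and $\mathcal B_r$ is the full subcategory of projective-injective objects of $\mathcal B_{\le r}$.
   Context: $\mathcal B$ is the additive $\mathbb k$-category (objects are finite ordered direct sums of indecomposables) with one indecomposable object $M(x,y)$ for each $(x,y)\in\mathbb R^2$, with $\mathrm{Hom}(M(x,y),M(x',y'))=\mathbb k$ if $x\le x'$ and $y\le y'$, and $0$ otherwise; composition is multiplication of scalars. $\mathcal B$ is an exact category via the following embedding. A representation of $\mathbb R$ assigns a $\mathbb k$-vector space $V_x$ to each $x\in\mathbb R$ and compatible linear maps $V_{xy}:V_y\to V_x$ for $x<y$; for $a<b$, $V_{(a,b]}$ is the representation equal to $\mathbb k$ on $(a,b]$, with identity structure maps there, and $0$ elsewhere. The assignment $M(x,y)\mapsto V_{(-e^{-x},\,e^{y}]}$, sending the morphism $1\in\mathbb k$ to the morphism that is the identity wherever both representations are $\mathbb k$, identifies $\mathcal B$ with an extension-closed full subcategory of the abelian category of representations of $\mathbb R$ that are pointwise finite dimensional, have finitely many critical values, and satisfy: for every $x$, $V_{yx}:V_x\to V_y$ is an isomorphism for all $y<x$ sufficiently close to $x$ (critical values being the real numbers $x$ for which it is false that $V_{xy}$ is an isomorphism for all $y>x$ sufficiently close to $x$). A sequence in $\mathcal B$ is exact iff its image is a short exact sequence of representations. $\mathcal B_{\le r}$ is the full additive subcategory of $\mathcal B$ generated by the $M(x,y)$ with $|y-x|\le r$, with exact sequences those sequences exact in $\mathcal B$ with all three terms in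 $\mathcal B_{\le r}$. $\mathcal B_r$ is the full additive subcategory generated by the $M(x,y)$ with $|y-x|=r$. A Frobenius category is an exact category with enough projectives and enough injectives in which projectives and injectives coincide. *)

(* Defs.v *)
From HB Require Import structures.
From mathcomp Require Import all_boot all_order all_algebra.
From mathcomp Require Import reals sequences exp.

Set Implicit Arguments.
Unset Strict Implicit.
Unset Printing Implicit Defensive.

Import Order.TTheory GRing.Theory Num.Theory.
Local Open Scope ring_scope.

Record kcat (k : fieldType) := KCat {
  ob :> Type;
  mor : ob -> ob -> lmodType k;
  idm : forall X, mor X X;
  cmp : forall X Y Z, mor Y Z -> mor X Y -> mor X Z;
  cmpA : forall W X Y Z (h : mor Y Z) (g : mor X Y) (f : mor W X),
    cmp h (cmp g f) = cmp (cmp h g) f;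
  cmpm1 : forall X Y (f : mor X Y), cmp f (idm X) = f;
  cmp1m : forall X Y (f : mor X Y), cmp (idm Y) f = f;
  cmp_linearr : forall X Y Z (g : mor Y Z) a (f f' : mor X Y),
    cmp g (a *: f + f') = a *: cmp g f + cmp g f';
  cmp_linearl : forall X Y Z (f : mor X Y) a (g g' : mor Y Z),
    cmp (a *: g + g') f = a *: cmp g f + cmp g' f
}.

Arguments mor {k C} X Y : rename.
Arguments idm {k C} X : rename.
Arguments cmp {k C X Y Z} g f : rename.

Definition full_sub (k : fieldType) (C : kcat k) (P : C -> Prop) : kcat k :=
  @KCat k {X : C | P X} (fun X Y => mor (sval X) (sval Y))
    (fun X => idm (sval X)) (fun _ _ _ g f => cmp g f)
    (fun _ _ _ _ => @cmpA k C _ _ _ _) (fun _ _ => @cmpm1 k C _ _)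
    (fun _ _ => @cmp1m k C _ _) (fun _ _ _ => @cmp_linearr k C _ _ _)
    (fun _ _ _ => @cmp_linearl k C _ _ _).

Definition seq_class (k : fieldType) (C : kcat k) : Type :=
  forall X Y Z : C, mor X Y -> mor Y Z -> Prop.

Definition full_sub_seq (k : fieldType) (C : kcat k) (P : C -> Prop)
    (E : seq_class C) : seq_class (full_sub P) :=
  fun X Y Z f g => E (sval X) (sval Y) (sval Z) f g.

Section Exact.
Variables (k : fieldType) (C : kcat k).
Implicit Types X Y Z W : C.

Definition is_zero_object Z : Prop :=
  (forall X (f g : mor Z X), f = g) /\ (forall X (f g : mor X Z), f = g).

Definition is_biproduct X Y S (i1 : mor X S) (i2 : mor Y S)
    (p1 : mor S X) (p2 : mor S Y) : Prop :=
  [/\ cmp p1 i1 = idm X, cmp p2 i2 = idm Y, cmp p1 i2 = 0, cmp p2 i1 = 0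
    & cmp i1 p1 + cmp i2 p2 = idm S].

Definition additive_category : Prop :=
  (exists Z, is_zero_object Z) /\
  (forall X Y, exists S i1 i2 p1 p2, @is_biproduct X Y S i1 i2 p1 p2).

Definition is_iso X Y (f : mor X Y) : Prop :=
  exists g : mor Y X, cmp g f = idm X /\ cmp f g = idm Y.

Definition is_kernel X Y Z (f : mor X Y) (g : mor Y Z) : Prop :=
  cmp g f = 0 /\
  forall W (h : mor W Y), cmp g h = 0 -> exists! h' : mor W X, cmp f h' = h.

Definition is_cokernel X Y Z (f : mor X Y) (g : mor Y Z) : Prop :=
  cmp g f = 0 /\
  forall W (h : mor Y W), cmp h f = 0 -> exists! h' : mor Z W, cmp h' g = h.

Definition is_pullback Y' Y Z' Z (p : mor Y Z) (u : mor Z' Z)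
    (u' : mor Y' Y) (p' : mor Y' Z') : Prop :=
  cmp p u' = cmp u p' /\
  forall W (a : mor W Y) (b : mor W Z'), cmp p a = cmp u b ->
    exists! c : mor W Y', cmp u' c = a /\ cmp p' c = b.

Definition is_pushout X Y X' Y' (i : mor X Y) (u : mor X X')
    (u' : mor Y Y') (i' : mor X' Y') : Prop :=
  cmp u' i = cmp i' u /\
  forall W (a : mor Y W) (b : mor X' W), cmp a i = cmp b u ->
    exists! c : mor Y' W, cmp c u' = a /\ cmp c i' = b.

Variable E : seq_class C.

Definition inflation X Y (f : mor X Y) : Prop :=
  exists Z (g : mor Y Z), E f g.

Definition deflation Y Z (g : mor Y Z) : Prop :=
  exists X (f : mor X Y), E f g.

(* Quillen's axioms, in the self-dual form of Keller and Buehler. *)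
Record exact_category : Prop := ExactCategory {
  exact_additive : additive_category;
  exact_iso : forall X Y Z X' Y' Z' (f : mor X Y) (g : mor Y Z)
    (f' : mor X' Y') (g' : mor Y' Z')
    (a : mor X X') (b : mor Y Y') (c : mor Z Z'),
    is_iso a -> is_iso b -> is_iso c ->
    cmp b f = cmp f' a -> cmp c g = cmp g' b -> E f g -> E f' g';
  exact_kernel : forall X Y Z (f : mor X Y) (g : mor Y Z),
    E f g -> is_kernel f g;
  exact_cokernel : forall X Y Z (f : mor X Y) (g : mor Y Z),
    E f g -> is_cokernel f g;
  inflation_id : forall X, inflation (idm X);
  deflation_id : forall X, deflation (idm X);
  inflation_comp : forall X Y Z (f : mor X Y) (g : mor Y Z),
    inflation f -> inflation g -> inflation (cmp g f);
  deflation_comp : forall X Y Z (f : mor X Y) (g : mor Y Z),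
    deflation f -> deflation g -> deflation (cmp g f);
  inflation_pushout : forall X Y X' (i : mor X Y) (u : mor X X'),
    inflation i -> exists Y' (u' : mor Y Y') (i' : mor X' Y'),
      is_pushout i u u' i' /\ inflation i';
  deflation_pullback : forall Y Z Z' (p : mor Y Z) (u : mor Z' Z),
    deflation p -> exists Y' (u' : mor Y' Y) (p' : mor Y' Z'),
      is_pullback p u u' p' /\ deflation p'
}.

Definition projective P : Prop :=
  forall Y Z (p : mor Y Z) (f : mor P Z), deflation p ->
    exists g : mor P Y, cmp p g = f.

Definition injective_object I : Prop :=
  forall X Y (i : mor X Y) (f : mor X I), inflation i ->
    exists g : mor Y I, cmp g i = f.

Definition enough_projectives : Prop :=
  forall Z, exists P (p : mor P Z), projective P /\ deflation p.

Definition enough_injectives : Prop :=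
  forall X, exists I (i : mor X I), injective_object I /\ inflation i.

Definition frobenius_category : Prop :=
  [/\ exact_category, enough_projectives, enough_injectives
    & forall X, projective X <-> injective_object X].

End Exact.

Record rep (k : fieldType) (R : realType) := Rep {
  rep_space :> R -> lmodType k;
  rep_map : forall x y : R, x < y -> {linear rep_space y -> rep_space x};
  rep_mapM : forall (x y z : R) (xy : x < y) (yz : y < z) (xz : x < z) v,
    rep_map xz v = rep_map xy (rep_map yz v)
}.

Record rep_hom (k : fieldType) (R : realType) (V W : rep k R) := RepHom {
  rep_hom_at :> forall x : R, {linear V x -> W x};
  rep_hom_natural : forall (x y : R) (xy : x < y) v,
    rep_hom_at x (rep_map V xy v) = rep_map W xy (rep_hom_at y v)
}.

Definition rep_short_exact (k : fieldType) (R : realType) (U V W : rep k R)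
    (f : rep_hom U V) (g : rep_hom V W) : Prop :=
  forall x : R,
  [/\ injective (f x),
      forall v, g x v = 0 <-> exists u, f x u = v
    & forall w, exists v, g x v = w].

(* [:: (x_1, y_1); ...; (x_n, y_n)] stands for the ordered direct sum
   M(x_1, y_1) (+) ... (+) M(x_n, y_n). *)
Definition Bob (R : realType) : Type := seq (R * R).

Definition summand (R : realType) (X : Bob R) (i : 'I_(size X)) : R * R :=
  tnth (in_tuple X) i.

Definition leM (R : realType) (p q : R * R) : bool :=
  (p.1 <= q.1) && (p.2 <= q.2).

Lemma leM_refl (R : realType) : reflexive (@leM R).
Proof. by move=> p; rewrite /leM !lexx. Qed.

Lemma leM_trans (R : realType) : transitive (@leM R).
Proof.
move=> q p s /andP[h1 h2] /andP[h3 h4].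
by apply/andP; split; [apply: le_trans h3 | apply: le_trans h4].
Qed.

Section Bhom.
Variables (k : fieldType) (R : realType).
Implicit Types X Y Z : Bob R.

(* The (j, i) entry of a morphism X -> Y is its component from the i-th
   summand of X to the j-th summand of Y. *)
Definition Bhom_pred X Y : {pred 'M[k]_(size Y, size X)} :=
  [pred A : 'M[k]_(size Y, size X) |
    [forall j, forall i, leM (summand i) (summand j) || (A j i == 0)]].
Arguments Bhom_pred : clear implicits.

Lemma Bhom_predP X Y (A : 'M[k]_(size Y, size X)) :
  reflect (forall j i, ~~ leM (summand i) (summand j) -> A j i = 0)
          (A \in Bhom_pred X Y).
Proof.
apply: (iffP forallP) => [h j i | h j].
  by move: (forallP (h j) i) => /orP[-> // | /eqP].
by apply/forallP => i; case: (boolP (leM _ _)) => //= /h ->; rewrite eqxx.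
Qed.

Fact Bhom_submod X Y : subsemimod_closed (Bhom_pred X Y).
Proof.
split; first split.
- by apply/Bhom_predP => j i _; rewrite mxE.
- move=> A B /Bhom_predP hA /Bhom_predP hB.
  by apply/Bhom_predP => j i h; rewrite mxE hA // hB // addr0.
- move=> a A /Bhom_predP hA.
  by apply/Bhom_predP => j i h; rewrite mxE hA // mulr0.
Qed.

HB.instance Definition _ X Y :=
  GRing.isSubmodClosed.Build k _ (Bhom_pred X Y) (Bhom_submod X Y).

Record Bhom X Y := BHom {
  Bmx :> 'M[k]_(size Y, size X);
  Bmx_in : Bmx \in Bhom_pred X Y
}.

HB.instance Definition _ X Y := [isSub for @Bmx X Y].
HB.instance Definition _ X Y := [Choice of Bhom X Y by <:].
HB.instance Definition _ X Y := [SubChoice_isSubLmodule of Bhom X Y by <:].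

Fact Bid_subproof X : 1%:M \in Bhom_pred X X.
Proof.
apply/Bhom_predP => j i h; rewrite mxE; case: eqP => // eji.
by rewrite eji leM_refl in h.
Qed.

Definition Bid X : Bhom X X := BHom (Bid_subproof X).

Fact Bcomp_subproof X Y Z (g : Bhom Y Z) (f : Bhom X Y) :
  Bmx g *m Bmx f \in Bhom_pred X Z.
Proof.
apply/Bhom_predP => l i h; rewrite mxE big1 // => j _.
case: (boolP (leM (summand i) (summand j))) => [hij | nij].
  case: (boolP (leM (summand j) (summand l))) => [hjl | njl].
    by rewrite (leM_trans hij hjl) in h.
  by rewrite (Bhom_predP _ (Bmx_in g)) // mul0r.
by rewrite (Bhom_predP _ (Bmx_in f)) // mulr0.
Qed.

Definition Bcomp X Y Z (g : Bhom Y Z) (f : Bhom X Y) : Bhom X Z :=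
  BHom (Bcomp_subproof g f).

Fact BcompA W X Y Z (h : Bhom Y Z) (g : Bhom X Y) (f : Bhom W X) :
  Bcomp h (Bcomp g f) = Bcomp (Bcomp h g) f.
Proof. by apply: val_inj; rewrite /= mulmxA. Qed.

Fact Bcompm1 X Y (f : Bhom X Y) : Bcomp f (Bid X) = f.
Proof. by apply: val_inj; rewrite /= mulmx1. Qed.

Fact Bcomp1m X Y (f : Bhom X Y) : Bcomp (Bid Y) f = f.
Proof. by apply: val_inj; rewrite /= mul1mx. Qed.

Fact Bcomp_linearr X Y Z (g : Bhom Y Z) (a : k) (f f' : Bhom X Y) :
  Bcomp g (a *: f + f') = a *: Bcomp g f + Bcomp g f'.
Proof. by apply: val_inj; rewrite /= mulmxDr -scalemxAr. Qed.

Fact Bcomp_linearl X Y Z (f : Bhom X Y) (a : k) (g g' : Bhom Y Z) :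
  Bcomp (a *: g + g') f = a *: Bcomp g f + Bcomp g' f.
Proof. by apply: val_inj; rewrite /= mulmxDl -scalemxAl. Qed.

Definition B : kcat k :=
  @KCat k (Bob R) (fun X Y => Bhom X Y : lmodType k) Bid Bcomp
    BcompA Bcompm1 Bcomp1m Bcomp_linearr Bcomp_linearl.

End Bhom.

(* V_(a, b] is k^1 at the points of (a, b] and k^0 elsewhere, so a direct sum
   of n such representations has at t the dimension \sum_i (t in the i-th
   interval), the boolean counting as 0 or 1. [trunc_mx q p A] is A with the
   i-th column (resp. j-th row) deleted when p i (resp. q j) is false: the
   block const_mx 1 is the identity of k when both sides are k, and an empty
   matrix otherwise. *)
Definition trunc_mx (k : fieldType) (m n : nat) (q : 'I_m -> bool)
    (p : 'I_n -> bool) (A : 'M[k]_(m, n)) :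
    'M[k]_(\sum_j q j, \sum_i p i) :=
  \mxblock_(j, i) (A j i *: const_mx 1).

Lemma trunc_mx_mul (k : fieldType) (m n l : nat) (q : 'I_m -> bool)
    (p : 'I_n -> bool) (s : 'I_l -> bool)
    (A : 'M[k]_(m, n)) (A' : 'M[k]_(n, l)) :
  (forall j i h, A j i * A' i h != 0 -> q j -> s h -> p i) ->
  trunc_mx q p A *m trunc_mx p s A' = trunc_mx q s (A *m A').
Proof.
move=> hp; rewrite /trunc_mx mul_mxblock; apply: eq_mxblock => j h.
rewrite mxE scaler_suml; apply: eq_bigr => i _.
rewrite -scalemxAl -scalemxAr scalerA.
have [-> | nz] := eqVneq (A j i * A' i h) 0; first by rewrite !scale0r.
congr (_ *: _); apply/matrixP => a b; rewrite !mxE.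
have qj : q j by move: a; case: (q j) => // -[].
have sh : s h by move: b; case: (s h) => // -[].
under eq_bigr do rewrite !mxE mulr1.
by rewrite (hp _ _ _ nz qj sh) big_const_ord /= addr0.
Qed.

Section Embedding.
Variables (k : fieldType) (R : realType).
Implicit Types X Y Z : B k R.

(* M(x, y) is sent to V_(- e^(- x), e^y]. *)
Definition suppM (p : R * R) (t : R) : bool :=
  t \in `] - expR (- p.1), expR p.2 ].

Lemma suppM_conv p (s t u : R) :
  s < t -> t < u -> suppM p s -> suppM p u -> suppM p t.
Proof.
rewrite /suppM !in_itv /= => st tu /andP[h1 _] /andP[_ h2].
by rewrite (lt_trans h1 st) (le_trans (ltW tu) h2).
Qed.

Lemma suppM_src p q (s t : R) :
  leM p q -> s < t -> suppM p t -> suppM q s -> suppM p s && suppM q t.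
Proof.
rewrite /suppM !in_itv /= => /andP[h1 h2] st /andP[p1 p2] /andP[q1 q2].
rewrite (lt_trans q1 st) (le_trans (ltW st) p2).
rewrite (le_trans p2) ?ler_expR // !andbT.
by rewrite (le_lt_trans _ q1) // lerN2 ler_expR lerN2.
Qed.

Definition supp X (t : R) (i : 'I_(size X)) : bool := suppM (summand i) t.
Arguments supp : clear implicits.

Definition F_space X (t : R) : lmodType k := 'cV[k]_(\sum_i supp X t i).

(* The structure maps are those of the summands, hence the truncated identity
   matrix. *)
Definition F_map X (s t : R) (_ : s < t) : {linear F_space X t -> F_space X s} :=
  mulmx (trunc_mx (supp X s) (supp X t) 1%:M).

Fact F_mapM X (s t u : R) (st : s < t) (tu : t < u) (su : s < u) v :
  F_map X su v = F_map X st (F_map X tu v).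
Proof.
rewrite /F_map /= mulmxA trunc_mx_mul ?mulmx1 // => j i h.
rewrite !mxE; have [-> | _] := eqVneq j i; last by rewrite mul0r eqxx.
have [-> _ | _] := eqVneq i h; last by rewrite mulr0 eqxx.
exact: suppM_conv.
Qed.

Definition F_ob X : rep k R := Rep (@F_mapM X).

Definition F_at X Y (f : mor X Y) (t : R) : {linear F_ob X t -> F_ob Y t} :=
  mulmx (trunc_mx (supp Y t) (supp X t) (Bmx f)).

Fact F_natural X Y (f : mor X Y) (s t : R) (st : s < t) v :
  F_at f s (rep_map (F_ob X) st v) = rep_map (F_ob Y) st (F_at f t v).
Proof.
have le_supp j i : Bmx f j i != 0 -> supp Y s j -> supp X t i ->
    supp X s i && supp Y t j.
  move=> nz hj hi; apply: (suppM_src _ st hi hj); apply: contraR nz => h.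
  by rewrite (Bhom_predP _ (Bmx_in f)).
rewrite /F_at /= /F_map /= !mulmxA !trunc_mx_mul ?mulmx1 ?mul1mx //.
- move=> j i h; rewrite [1%:M _ _]mxE.
  have [<- | _] := eqVneq j i; last by rewrite mul0r eqxx.
  by rewrite mul1r => nz hj hh; case/andP: (le_supp _ _ nz hj hh).
- move=> j i h; rewrite [1%:M _ _]mxE.
  have [-> | _] := eqVneq i h; last by rewrite mulr0 eqxx.
  by rewrite mulr1 => nz hj hh; case/andP: (le_supp _ _ nz hj hh).
Qed.

Definition F_hom X Y (f : mor X Y) : rep_hom (F_ob X) (F_ob Y) :=
  RepHom (F_natural f).

End Embedding.

Definition B_exact (k : fieldType) (R : realType) : seq_class (B k R) :=
  fun X Y Z f g => rep_short_exact (F_hom f) (F_hom g).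

Definition in_B_le (k : fieldType) (R : realType) (r : R) (X : B k R) : bool :=
  all (fun p : R * R => `|p.2 - p.1| <= r) X.

Definition in_B_eq (k : fieldType) (R : realType) (r : R) (X : B k R) : bool :=
  all (fun p : R * R => `|p.2 - p.1| == r) X.

Definition B_le (k : fieldType) (R : realType) (r : R) : kcat k :=
  full_sub (fun X : B k R => in_B_le r X).

Definition B_le_exact (k : fieldType) (R : realType) (r : R) :
    seq_class (B_le k r) :=
  full_sub_seq (P := fun X => in_B_le r X) (@B_exact k R).

(* Main.v *)
(* At the point 0 of the line a representation V_(-e^(-x), e^y] is k, so the
   fibre at 0 sends B faithfully to vector spaces; the fibres at t > 0 and at
   t < 0 are the pieces of a y-filtration and the quotients by an x-filtration
   of that space. Thus B is the category of finite-dimensional spaces with two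
   decreasing filtrations, exactness meaning strict exactness for both, and
   |y - x| <= r says that each filtration is contained in the other one shifted
   by r. The latter passes to strict subspaces and strict quotients, although
   not to extensions. As two filtrations always have a common adapted basis,
   kernels and cokernels can be computed on vector spaces, which yields the
   exact structure.
   If |y - x| = r, the intersection of the filtrations at levels x and y is one
   of them, so Hom(M(x, y), -) and Hom(-, M(x, y)) are exact. The sequences
   M(y-r, x-r) -> M(x, x-r) + M(y-r, y) -> M(x, y) and
   M(x, y) -> M(x, x+r) + M(y+r, y) -> M(y+r, x+r) give enough projectives and
   injectives in B_r, and B_r is closed under retracts. *)
Require Import Defs.
From mathcomp Require Import all_boot all_order all_algebra reals.
From mathcomp Require Import boolp sequences exp lra.
Local Open Scope ring_scope.

Set Implicit Arguments.
Unset Strict Implicit.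
Unset Printing Implicit Defensive.

Import Order.TTheory GRing.Theory Num.Theory.

(** * Linear algebra on column vectors: liftings, kernels and cokernels of matrices *)

Lemma mulmx_inj (k : fieldType) (m n : nat) (A C : 'M[k]_(m, n)) :
  (forall v : 'cV_n, A *m v = C *m v) -> A = C.
Proof.
by move=> eqA; apply/trmx_inj/row_matrixP => i; rewrite -!tr_col !colE eqA.
Qed.

Lemma mulmx_lift (k : fieldType) (m n p : nat) (A : 'M[k]_(m, n))
    (C : 'M[k]_(m, p)) :
  (forall v : 'cV_p, exists u : 'cV_n, A *m u = C *m v) ->
  exists D, A *m D = C.
Proof.
move=> eqA.
have /fin_all_exists[d dP] (j : 'I_p) : exists u : 'cV_n, A *m u = col j C.
  by have [u uE] := eqA (delta_mx j 0); exists u; rewrite uE colE.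
exists (\matrix_(i, j) d j i 0); apply/matrixP => i j.
have := congr1 (fun v : 'cV_m => v i 0) (dP j).
by rewrite !mxE => <-; apply: eq_bigr => l _; rewrite mxE.
Qed.

Lemma mulmx_kernel (k : fieldType) (m n : nat) (A : 'M[k]_(m, n)) :
  exists d (J : 'M[k]_(n, d)),
    (forall v : 'cV_d, J *m v = 0 -> v = 0) /\
    (forall w : 'cV_n, A *m w = 0 <-> exists v, J *m v = w).
Proof.
exists _, (row_base (kermx A^T))^T; split=> [v|w].
  move/(congr1 trmx); rewrite trmx_mul trmxK trmx0 => /eqP.
  rewrite mulmx_free_eq0 ?row_base_free // => /eqP/(congr1 trmx).
  by rewrite trmxK trmx0.
split=> [Aw|[v <-]].
  have: (w^T <= row_base (kermx A^T))%MS.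
    by rewrite eq_row_base; apply/sub_kermxP; rewrite -trmx_mul Aw trmx0.
  case/submxP => v /(congr1 trmx); rewrite trmx_mul trmxK => ->.
  by exists v^T.
apply: trmx_inj; rewrite 2!trmx_mul trmxK trmx0.
have /sub_kermxP : (row_base (kermx A^T) <= kermx A^T)%MS.
  by rewrite eq_row_base.
by rewrite -mulmxA => ->; rewrite mulmx0.
Qed.

(** The value of [d] is recorded for the induction on dimension that produces adapted bases: the
    quotient by a nonzero vector is smaller. *)
Lemma mulmx_cokernel (k : fieldType) (m n : nat) (A : 'M[k]_(m, n)) :
  exists d (Q : 'M[k]_(d, m)),
    [/\ d = (m - \rank A)%N, forall w : 'cV_d, exists v, Q *m v = w
      & forall v : 'cV_m, Q *m v = 0 <-> exists u, A *m u = v].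
Proof.
pose C := cokermx A^T; exists _, (col_base C)^T; split=> [|w|v].
  by rewrite mxrank_coker mxrank_tr.
  have /submxP[v vE] : (w^T <= col_base C)%MS.
    by rewrite submx_full ?col_base_full.
  by exists v^T; rewrite -trmx_mul -vE trmxK.
have -> : ((col_base C)^T *m v = 0) <-> (v^T <= A^T)%MS.
  have vC : (v^T *m C == 0) = (v^T *m col_base C == 0).
    by rewrite -[in LHS](mulmx_base C) mulmxA mulmx_free_eq0 ?row_base_free.
  rewrite submxE vC; split=> [/(congr1 trmx)|/eqP/(congr1 trmx)];
    by rewrite trmx_mul !trmxK trmx0 => ->.
split=> [/submxP[u /(congr1 trmx)]|[u <-]].
  by rewrite trmxK trmx_mul trmxK => ->; exists u^T.
by rewrite trmx_mul submxMl.
Qed.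

(** * Truncated matrices *)

Section Truncation.
Variable k : fieldType.
Implicit Types n m l : nat.

Definition supported n (p : 'I_n -> bool) (v : 'cV[k]_n) : Prop :=
  forall i, v i 0 != 0 -> p i.

(** All blocks have size 0 or 1, so [tagnat.sig1] identifies the indices of [\sum_i p i] with the
    [i] satisfying [p]. Under this identification [restr] and [extend] are the projection onto a
    coordinate subspace and its inclusion. *)
Definition restr n (p : 'I_n -> bool) (v : 'cV[k]_n) : 'cV[k]_(\sum_i p i) :=
  \col_s v (tagnat.sig1 s) 0.

Definition extend n (p : 'I_n -> bool) (w : 'cV[k]_(\sum_i p i)) : 'cV[k]_n :=
  \col_i \sum_s w s 0 * (tagnat.sig1 s == i)%:R.

Global Arguments extend {n} p w.

Lemma sig1_bool_inj n (p : 'I_n -> bool) :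
  injective (@tagnat.sig1 n (fun i => p i : nat)).
Proof.
move=> s t st; apply: tagnat.sig_inj; move: st; rewrite /tagnat.sig1.
case: (tagnat.sig s) (tagnat.sig t) => [i a] [j b] /= ij.
case: j / ij b => b; congr (existT _ _ _).
by case: (p i) a b => [a b|[]//]; rewrite !ord1.
Qed.

Lemma sig1_bool n (p : 'I_n -> bool) s :
  p (@tagnat.sig1 n (fun i => p i : nat) s).
Proof. by have := tagnat.sig2 s; case: (p _) => // -[]. Qed.

Lemma sig1_bool_onto n (p : 'I_n -> bool) i :
  p i -> exists s, @tagnat.sig1 n (fun i => p i : nat) s = i.
Proof.
move=> pi; have lt0 : (0 < p i)%N by rewrite pi.
exists (@tagnat.Rank n (fun i => p i : nat) i (Ordinal lt0)).
by rewrite tagnat.Rank1K.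
Qed.

Lemma extendE n (p : 'I_n -> bool) w s : extend p w (tagnat.sig1 s) 0 = w s 0.
Proof.
rewrite mxE (bigD1 s) //= eqxx mulr1 [X in _ + X]big1 ?addr0 // => t ts.
by rewrite (inj_eq (@sig1_bool_inj _ p)) (negPf ts) mulr0.
Qed.

Lemma extend_supported n (p : 'I_n -> bool) w : supported p (extend p w).
Proof.
move=> i; apply: contraNT => npi; rewrite mxE big1 // => s _.
case: eqP => [si|_]; last by rewrite mulr0.
by rewrite -si sig1_bool in npi.
Qed.

Global Arguments extend_supported {n} p w.

Lemma extendK n (p : 'I_n -> bool) : cancel (extend p) (restr p).
Proof. by move=> w; apply/matrixP => s j; rewrite ord1 mxE extendE. Qed.

Global Arguments extendK {n} p.

Lemma restrK n (p : 'I_n -> bool) v : supported p v -> extend p (restr p v) = v.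
Proof.
move=> pv; apply/matrixP => i j; rewrite ord1; case: (boolP (p i)) => [pi|npi].
  by have [s <-] := sig1_bool_onto pi; rewrite extendE mxE.
have /eqP -> : v i 0 == 0 by apply: contraNT npi => /pv.
by apply/eqP; apply: contraNT npi => /extend_supported.
Qed.

Lemma restr_eq0 n (p : 'I_n -> bool) v :
  restr p v = 0 <-> supported (fun i => ~~ p i) v.
Proof.
split=> [v0 i|pv].
  apply: contraNN => pi; have [s <-] := sig1_bool_onto pi.
  by have /matrixP/(_ s 0) := v0; rewrite !mxE => ->.
apply/matrixP => s j; rewrite !mxE; apply/eqP.
by apply: contraT => /pv; rewrite sig1_bool.
Qed.

Lemma restrB n (p : 'I_n -> bool) v w :
  restr p (v - w) = restr p v - restr p w.
Proof. by apply/matrixP => s j; rewrite !mxE. Qed.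

Lemma extend_restr n (p : 'I_n -> bool) v :
  supported (fun i => ~~ p i) (v - extend p (restr p v)).
Proof. by apply/restr_eq0; rewrite restrB extendK subrr. Qed.

(** This trades matrices whose size varies along the line for maps between coordinate subspaces of
    fixed spaces. *)
Lemma trunc_mxE m n (q : 'I_m -> bool) (p : 'I_n -> bool) (A : 'M_(m, n)) w :
  trunc_mx q p A *m w = restr q (A *m extend p w).
Proof.
apply/matrixP => s j; rewrite ord1 !mxE.
under [RHS]eq_bigr do rewrite mxE big_distrr /=.
rewrite exchange_big /=; apply: eq_bigr => t _.
rewrite [RHS](bigD1 (tagnat.sig1 t)) //= eqxx mulr1 [X in _ + X]big1 ?addr0;
  last first.
  by move=> i; rewrite eq_sym => /negPf ->; rewrite !mulr0.
by rewrite !mxE mulr1.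
Qed.

Lemma supportedB n (p : 'I_n -> bool) v w :
  supported p v -> supported p w -> supported p (v - w).
Proof.
move=> pv pw i; rewrite !mxE; have [->|/pv//] := eqVneq (v i 0) 0.
by rewrite sub0r oppr_eq0 => /pw.
Qed.

(** The clauses of [rep_short_exact] at a single point of the line, phrased so that [B_exactE] holds
    by conversion. *)
Definition trunc_exact n m l (p : 'I_n -> bool) (q : 'I_m -> bool)
    (s : 'I_l -> bool) (f : 'M[k]_(m, n)) (g : 'M[k]_(l, m)) : Prop :=
  [/\ injective (mulmx (trunc_mx q p f) : 'cV_(\sum_i p i) -> _),
      forall v : 'cV_(\sum_i q i), trunc_mx s q g *m v = 0 <->
        exists u : 'cV_(\sum_i p i), trunc_mx q p f *m u = v
    & forall w : 'cV_(\sum_i s i), exists v : 'cV_(\sum_i q i),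
        trunc_mx s q g *m v = w].

(** When supported vectors are preserved, truncating amounts to restricting to the subspaces they
    form. This is the situation at the points [t >= 0]. *)
Lemma trunc_exact_sub n m l (p : 'I_n -> bool) (q : 'I_m -> bool)
    (s : 'I_l -> bool) (f : 'M[k]_(m, n)) (g : 'M[k]_(l, m)) :
  (forall a, supported p a -> supported q (f *m a)) ->
  (forall a, supported q a -> supported s (g *m a)) ->
  trunc_exact p q s f g <->
  [/\ forall a, supported p a -> f *m a = 0 -> a = 0,
      forall y, supported q y ->
        (g *m y = 0 <-> exists2 a, supported p a & f *m a = y)
    & forall z, supported s z -> exists2 y, supported q y & g *m y = z].
Proof.
move=> pf qg; split=> [[inj mid srj]|[inj mid srj]]; split.
- move=> a pa fa0; rewrite -(restrK pa).
  suff -> : restr p a = 0.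
    by apply/matrixP => i j; rewrite !mxE big1 // => ? _; rewrite mxE mul0r.
  apply: inj; rewrite mulmx0 trunc_mxE restrK // fa0.
  by apply/matrixP => i j; rewrite !mxE.
- move=> y qy; have := mid (restr q y); rewrite trunc_mxE restrK // => hy.
  split=> [gy0|[a pa <-]].
    have [|u] := hy.1; first by rewrite gy0; apply/matrixP => i j; rewrite !mxE.
    rewrite trunc_mxE => uE; exists (extend p u); first exact: extend_supported.
    by rewrite -(restrK qy) -uE restrK //; apply/pf/extend_supported.
  have := mid (restr q (f *m a)); rewrite trunc_mxE restrK; last exact: pf.
  move=> h; have /restr_eq0 sg : restr s (g *m (f *m a)) = 0.
    by apply/h; exists (restr p a); rewrite trunc_mxE restrK.
  apply/matrixP => i j; rewrite [RHS]mxE ord1; apply/eqP; apply: contraT => nz.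
  by have := sg _ nz; rewrite (qg _ (pf _ pa) _ nz).
- move=> z sz; have [v] := srj (restr s z); rewrite trunc_mxE => vE.
  exists (extend q v); first exact: extend_supported.
  by rewrite -(restrK sz) -vE restrK //; apply/qg/extend_supported.
- move=> u u'; rewrite /= !trunc_mxE => uu'.
  rewrite -[u](extendK p) -[u'](extendK p).
  congr restr; apply/eqP; rewrite -subr_eq0; apply/eqP/inj.
    by apply: supportedB; exact: extend_supported.
  rewrite mulmxBr; apply/eqP; rewrite subr_eq0; apply/eqP.
  rewrite -(restrK (pf _ (extend_supported p u))) uu' restrK //.
  exact/pf/extend_supported.
- move=> v; rewrite trunc_mxE; split=> [gv0|[u <-]].
    have [|a pa fa] := (mid (extend q v) (extend_supported q v)).1.
      rewrite -(restrK (qg _ (extend_supported q v))) gv0.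
      by apply/matrixP => i j; rewrite !mxE big1 // => ? _; rewrite mxE mul0r.
    by exists (restr p a); rewrite trunc_mxE restrK // fa extendK.
  rewrite trunc_mxE restrK; last exact/pf/extend_supported.
  have pu := extend_supported p u; have qfu := pf _ pu.
  have -> : g *m (f *m extend p u) = 0.
    by apply/(mid _ qfu); exists (extend p u).
  by apply/matrixP => i j; rewrite !mxE.
- move=> w; have [y qy yE] := srj _ (extend_supported s w).
  by exists (restr q y); rewrite trunc_mxE restrK // yE extendK.
Qed.

(** When the vectors supported off [p], [q], [s] are preserved, the truncations are the maps induced
    on the quotients by them. This is the situation at the points [t < 0]. *)
Lemma trunc_exact_quot n m l (p : 'I_n -> bool) (q : 'I_m -> bool)
    (s : 'I_l -> bool) (f : 'M[k]_(m, n)) (g : 'M[k]_(l, m)) :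
  (forall a, supported (fun i => ~~ p i) a ->
     supported (fun i => ~~ q i) (f *m a)) ->
  (forall a, supported (fun i => ~~ q i) a ->
     supported (fun i => ~~ s i) (g *m a)) ->
  trunc_exact p q s f g <->
  [/\ forall a, supported (fun i => ~~ q i) (f *m a) ->
        supported (fun i => ~~ p i) a,
      forall y, supported (fun i => ~~ s i) (g *m y) <->
        exists a, supported (fun i => ~~ q i) (y - f *m a)
    & forall z, exists y, supported (fun i => ~~ s i) (z - g *m y)].
Proof.
move=> pf qg.
have truncE (n' m' : nat) (p' : 'I_n' -> bool) (q' : 'I_m' -> bool)
    (A : 'M[k]_(m', n')) :
  (forall a, supported (fun i => ~~ p' i) a ->
     supported (fun i => ~~ q' i) (A *m a)) ->
  forall a, trunc_mx q' p' A *m restr p' a = restr q' (A *m a).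
  move=> pA a; rewrite trunc_mxE.
  apply/eqP; rewrite eq_sym -subr_eq0; apply/eqP.
  by rewrite -restrB -mulmxBr; apply/restr_eq0/pA/extend_restr.
have fE := truncE _ _ _ _ _ pf; have gE := truncE _ _ _ _ _ qg.
split=> [[inj mid srj]|[inj mid srj]]; split.
- move=> a /restr_eq0; rewrite -fE => fa; apply/restr_eq0/inj.
  by rewrite /= fa mulmx0.
- move=> y; split=> [/restr_eq0|[a]].
    rewrite -gE => /mid[u]; rewrite -[u](extendK p) fE => uE.
    by exists (extend p u); apply/restr_eq0; rewrite restrB uE subrr.
  move/restr_eq0; rewrite restrB => /eqP; rewrite subr_eq0 => /eqP ya.
  by apply/restr_eq0; rewrite -gE; apply/mid; exists (restr p a); rewrite fE.
- move=> z; have [v] := srj (restr s z); rewrite -[v](extendK q) gE => vE.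
  by exists (extend q v); apply/restr_eq0; rewrite restrB vE subrr.
- move=> u u' /=; rewrite -[u](extendK p) -[u'](extendK p) !fE => /eqP.
  rewrite -subr_eq0 -restrB -mulmxBr => /eqP/restr_eq0/inj/restr_eq0/eqP.
  by rewrite restrB subr_eq0 => /eqP.
- move=> v; rewrite -[v](extendK q) gE.
  split=> [/restr_eq0/mid[a /restr_eq0]|[u]].
    rewrite restrB => /eqP; rewrite subr_eq0 => /eqP ->.
    by exists (restr p a); rewrite fE.
  rewrite -[u](extendK p) fE => uE; apply/restr_eq0/mid; exists (extend p u).
  by apply/restr_eq0; rewrite restrB uE subrr.
- move=> w; have [y /restr_eq0] := srj (extend s w); rewrite restrB extendK.
  by move/eqP; rewrite subr_eq0 => /eqP wE; exists (restr q y); rewrite gE -wE.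
Qed.

End Truncation.

(** * Exactness as strictness for two filtrations *)

Definition middle_exact (k : fieldType) (n m l : nat) (f : 'M[k]_(m, n))
    (g : 'M[k]_(l, m)) : Prop :=
  forall y : 'cV_m, g *m y = 0 <-> exists a : 'cV_n, f *m a = y.

Section Strictness.
Variables (k : fieldType) (R : realType).
Implicit Types (X Y Z : Bob R) (b : bool) (c : R).

(** The boolean names a filtration, by x for [true] and by y for [false]. Arguments common to both
    are thus made once, and [~~ b] is the other filtration. *)
Definition lev b (p : R * R) : R := if b then p.1 else p.2.

Definition Fil X b c : 'cV[k]_(size X) -> Prop :=
  supported (fun i => c <= lev b (summand i)).

Definition filtered X Y (A : 'M[k]_(size Y, size X)) : Prop :=
  forall b c a, Fil b c a -> Fil b c (A *m a).

Lemma Fil_delta X (i : 'I_(size X)) b :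
  Fil b (lev b (summand i)) (delta_mx i 0).
Proof.
move=> j; rewrite mxE eqxx andbT.
by case: (eqVneq j i) => [->|]; rewrite ?lexx ?eqxx.
Qed.

Global Arguments Fil_delta {X} i b.

Lemma Fil0 X b c : @Fil X b c 0.
Proof. by move=> i; rewrite mxE eqxx. Qed.

Lemma FilZD X b c a (u v : 'cV_(size X)) :
  Fil b c u -> Fil b c v -> Fil b c (a *: u + v).
Proof.
move=> Fu Fv i; rewrite !mxE => h; have [vi|/Fv//] := eqVneq (v i 0) 0.
by apply: Fu; apply: contraNneq h => ui; rewrite vi ui mulr0 addr0.
Qed.

Lemma FilB X b c (u v : 'cV_(size X)) :
  Fil b c u -> Fil b c v -> Fil b c (u - v).
Proof. by move=> Fu Fv; rewrite addrC -scaleN1r; apply: FilZD. Qed.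

(** A basis vector lies in each filtration at its own level, so preserving both filtrations forces
    both inequalities of [leM] at every nonzero entry. *)
Lemma Bhom_predE X Y (A : 'M[k]_(size Y, size X)) :
  A \in @Bhom_pred k R X Y <-> filtered A.
Proof.
split=> [/Bhom_predP BA b c a Fa j|fA].
  rewrite mxE; apply: contraNT => cj; rewrite big1 // => i _.
  have [->|/Fa ci] := eqVneq (a i 0) 0; first by rewrite mulr0.
  rewrite BA ?mul0r //; apply: contra cj => /andP[h1 h2].
  by apply: (le_trans ci); case: (b).
apply/Bhom_predP => j i; apply: contraNeq => Aji; rewrite /leM.
have nz : (A *m delta_mx i 0 : 'cV_(size Y)) j 0 != 0 by rewrite -colE mxE.
have le_lev b : lev b (summand i) <= lev b (summand j).
  exact: fA (Fil_delta i b) _ nz.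
by rewrite (le_lev true) (le_lev false).
Qed.

Lemma Bhom_filtered X Y (f : Bhom k X Y) : filtered (Bmx f).
Proof. exact/Bhom_predE/Bmx_in. Qed.

Global Arguments Bhom_filtered {X Y} f [b c a].

Lemma filtered_Bhom X Y (A : 'M[k]_(size Y, size X)) :
  filtered A -> exists f : Bhom k X Y, Bmx f = A.
Proof. by move/Bhom_predE => BA; exists (BHom BA). Qed.

Definition strict_mono X Y (A : 'M[k]_(size Y, size X)) : Prop :=
  forall b c a, Fil b c (A *m a) -> Fil b c a.

Definition strict_epi Y Z (A : 'M[k]_(size Z, size Y)) : Prop :=
  forall b c z, Fil b c z -> exists2 y, Fil b c y & A *m y = z.

Lemma Fil_lower_bound X : exists c, forall b (v : 'cV_(size X)), Fil b c v.
Proof.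
exists (- \sum_(i < size X) (`|(summand i).1| + `|(summand i).2|)) => b v i _.
rewrite lerNl (bigD1 i) //= ler_wpDr ?sumr_ge0 // => [j _|].
  by rewrite addr_ge0.
rewrite (le_trans (ler_norm _)) // normrN.
by case: b => /=; rewrite ?lerDl ?lerDr.
Qed.

Lemma Fil_upper_bound X b :
  exists c, forall v : 'cV_(size X), Fil b c v -> v = 0.
Proof.
exists (1 + \sum_(i < size X) `|lev b (summand i)|) => v Fv.
apply/matrixP => i j; rewrite mxE ord1; apply/eqP; apply: contraT => /Fv.
rewrite leNgt; case/negP; rewrite (bigD1 i) //= addrCA ltr_pwDr ?ler_norm //.
by rewrite ltr_wpDr ?sumr_ge0.
Qed.

(** At a high level [Fil] is zero, and strictness puts every vector of the kernel there. Dually,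
    surjectivity of strict epimorphisms comes from a low level, where [Fil] is the whole space. *)
Lemma strict_mono_inj X Y (A : 'M[k]_(size Y, size X)) (a : 'cV_(size X)) :
  strict_mono A -> A *m a = 0 -> a = 0.
Proof.
move=> Am Aa; have [c cP] := Fil_upper_bound X true.
by apply: cP; apply: Am; rewrite Aa; apply: Fil0.
Qed.

Lemma strict_epi_surj Y Z (A : 'M[k]_(size Z, size Y)) (z : 'cV_(size Z)) :
  strict_epi A -> exists y : 'cV_(size Y), A *m y = z.
Proof.
move=> Ae; have [c cP] := Fil_lower_bound Z.
by have [y _ yE] := Ae true c z (cP _ _); exists y.
Qed.

(** The point [expR c] tests the y-level against [c], and [- expR (- c)] tests the x-level. The
    second test is negated, which is why negative points see quotients instead of subspaces. *)
Lemma suppM_pos (p : R * R) c : suppM p (expR c) = (c <= lev false p).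
Proof.
rewrite /suppM in_itv /= ler_expR (lt_trans _ (expR_gt0 _)) //.
by rewrite oppr_lt0 expR_gt0.
Qed.

Lemma suppM_neg (p : R * R) c : suppM p (- expR (- c)) = ~~ (c <= lev true p).
Proof.
rewrite /suppM in_itv /= ltrN2 ltr_expR ltrN2 -ltNge andbC.
by rewrite (le_trans _ (expR_ge0 _)) // oppr_le0 expR_ge0.
Qed.

Lemma suppM0 (p : R * R) : suppM p 0.
Proof. by rewrite /suppM in_itv /= oppr_lt0 expR_gt0 expR_ge0. Qed.

Lemma B_exactE (X Y Z : B k R) (f : mor X Y) (g : mor Y Z) :
  B_exact f g <->
  forall t, trunc_exact (@supp k R X t) (@supp k R Y t) (@supp k R Z t)
    (Bmx f) (Bmx g).
Proof. by []. Qed.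

Lemma eq_trunc_exact n m l (p p' : 'I_n -> bool) (q q' : 'I_m -> bool)
    (s s' : 'I_l -> bool) (f : 'M[k]_(m, n)) (g : 'M[k]_(l, m)) :
  p =1 p' -> q =1 q' -> s =1 s' ->
  trunc_exact p q s f g = trunc_exact p' q' s' f g.
Proof. by move=> /funext -> /funext -> /funext ->. Qed.

Lemma eq_supported n (p p' : 'I_n -> bool) :
  p =1 p' -> @supported k n p = supported p'.
Proof. by move=> /funext ->. Qed.

(** The fibre at 0 gives exactness of the underlying spaces. Once this holds, exactness on the steps
    of the y-filtration ([t > 0]) and on the quotients by the steps of the x-filtration ([t < 0])
    each amount to strictness of both maps for the filtration concerned. *)
Lemma B_exactP (X Y Z : B k R) (f : mor X Y) (g : mor Y Z) :
  B_exact f g <->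
  [/\ strict_mono (Bmx f), strict_epi (Bmx g)
    & middle_exact (Bmx f) (Bmx g)].
Proof.
rewrite B_exactE.
have pos c : trunc_exact (@supp k R X (expR c)) (@supp k R Y (expR c))
     (@supp k R Z (expR c)) (Bmx f) (Bmx g) <->
   [/\ forall a, Fil false c a -> Bmx f *m a = 0 -> a = 0,
      forall y, Fil false c y ->
        (Bmx g *m y = 0 <-> exists2 a, Fil false c a & Bmx f *m a = y)
    & forall z, Fil false c z -> exists2 y, Fil false c y & Bmx g *m y = z].
  have E W : @supp k R W (expR c) =1 (fun i => c <= lev false (summand i)).
    by move=> i; rewrite /supp suppM_pos.
  rewrite (eq_trunc_exact _ _ (E X) (E Y) (E Z)).
  by apply: trunc_exact_sub => a; apply: Bhom_filtered.
have neg c : trunc_exact (@supp k R X (- expR (- c)))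
     (@supp k R Y (- expR (- c))) (@supp k R Z (- expR (- c)))
     (Bmx f) (Bmx g) <->
   [/\ forall a, Fil true c (Bmx f *m a) -> Fil true c a,
      forall y, Fil true c (Bmx g *m y) <->
        exists a, Fil true c (y - Bmx f *m a)
    & forall z, exists y, Fil true c (z - Bmx g *m y)].
  have E W : @supp k R W (- expR (- c)) =1
      (fun i => ~~ (c <= lev true (summand i))).
    by move=> i; rewrite /supp suppM_neg.
  have FE W : @Fil W true c =
      supported (fun i => ~~ ~~ (c <= lev true (summand i))).
    by apply: eq_supported => i; rewrite negbK.
  rewrite (eq_trunc_exact _ _ (E X) (E Y) (E Z)) !FE.
  by apply: trunc_exact_quot => a; rewrite -!FE; apply: Bhom_filtered.
have zero : trunc_exact (@supp k R X 0) (@supp k R Y 0)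
     (@supp k R Z 0) (Bmx f) (Bmx g) <->
   [/\ forall a : 'cV_(size X), Bmx f *m a = 0 -> a = 0,
      middle_exact (Bmx f) (Bmx g)
    & forall z : 'cV_(size Z), exists y : 'cV_(size Y), Bmx g *m y = z].
  have E W : @supp k R W 0 =1 (fun=> true) by move=> i; rewrite /supp suppM0.
  rewrite (eq_trunc_exact _ _ (E X) (E Y) (E Z)) trunc_exact_sub //.
  split=> -[h1 h2 h3]; split=> //.
  - by move=> a; apply: h1.
  - move=> y; rewrite h2 //; split=> [[a _ <-]|[a <-]]; by exists a.
  - by move=> z; have [//|y] := h3 z; exists y.
  - by move=> a _; apply: h1.
  - move=> y _; rewrite h2 //; split=> [[a <-]|[a _ <-]]; by exists a.
  - by move=> z _; have [y] := h3 z; exists y.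
split=> [ex|[fm ge mid] t].
  have [inj mid srj] := zero.1 (ex 0); split=> //.
  (* For x, strictness is injectivity on the quotients. For y, exactness at [expR c] provides a
     preimage of [f a] inside the step, and it equals [a] by injectivity at 0. *)
  - move=> [] c a; first by have [h _ _] := (neg c).1 (ex _); apply: h.
    have [_ h _] := (pos c).1 (ex (expR c)) => Ffa.
    have [|a' Fa' /eqP] := (h _ Ffa).1; first by apply/mid; exists a.
    rewrite -subr_eq0 -mulmxBr => /eqP/inj/eqP.
    by rewrite subr_eq0 => /eqP <-.
  (* For y this is surjectivity on the step. For x, any preimage [y] of [z] is congruent to some
     [f a] modulo the step, and [y - f a] is the preimage wanted. *)
  - move=> [] c z; last by have [_ _ h] := (pos c).1 (ex _); apply: h.
    have [y yE] := srj z; rewrite -yE => Fgy.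
    have [_ h _] := (neg c).1 (ex _).
    have [a Fa] := (h _).1 Fgy; exists (y - Bmx f *m a) => //.
    rewrite mulmxBr; suff -> : Bmx g *m (Bmx f *m a) = 0 by rewrite subr0.
    by apply/mid; exists a.
have gf (a : 'cV_(size X)) : Bmx g *m (Bmx f *m a) = 0 by apply/mid; exists a.
case: (ltrgtP t 0) => [t0|t0|->].
- have -> : t = - expR (- - ln (- t)).
    by rewrite opprK lnK ?opprK // posrE oppr_gt0.
  apply/neg; split=> [a|y|z]; first exact: fm.
    split=> [Fgy|[a Fa]].
      have [y' Fy' /eqP] := ge _ _ _ Fgy.
      rewrite eq_sym -subr_eq0 -mulmxBr => /eqP gy0.
      have [a aE] := (mid _).1 gy0.
      by exists a; rewrite aE subKr.
    by have := Bhom_filtered g Fa; rewrite mulmxBr gf subr0.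
  have [y yE] := strict_epi_surj z ge; exists y; rewrite yE subrr; exact: Fil0.
- have -> : t = expR (ln t) by rewrite lnK.
  apply/pos; split=> [a _|y Fy|z]; first exact: strict_mono_inj.
    split=> [gy0|[a _ <-]]; last exact: gf.
    have [a aE] := (mid _).1 gy0; exists a => //.
    by apply: fm; rewrite aE.
  exact: ge.
- apply/zero; split=> // [a|z]; first exact: strict_mono_inj.
  exact: strict_epi_surj.
Qed.

End Strictness.

(** * Common adapted bases of two filtrations *)

Section AdaptedBases.
Variables (k : fieldType) (R : realType).
Implicit Types (X Y Z : Bob R) (b : bool) (c : R).

(** The last field says at once that the filtrations are decreasing, exhaustive and separated, with
    finitely many jumps, and that a nonzero vector attains its level. In contrast to [Fil], no basis
    is fixed, so the notion passes to subspaces and quotients. *)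
Record bifiltration n (G : bool -> R -> 'cV[k]_n -> Prop) : Prop := {
  bifil0 : forall b c, G b c 0;
  bifilZD : forall b c a u v, G b c u -> G b c v -> G b c (a *: u + v);
  bifil_jumps : exists s : seq R, forall b v, v != 0 ->
    exists2 c, c \in s & forall c', G b c' v <-> c' <= c
}.

Lemma seq_argmax (s : seq R) (P : R -> Prop) :
  (exists2 c, c \in s & P c) ->
  exists2 c, c \in s & P c /\ forall c', c' \in s -> P c' -> c' <= c.
Proof.
elim: s => [[]//|d s IHs] [c cs Pc].
have [[e es Pe]|nP] := pselect (exists2 e, e \in s & P e); last first.
  have cd : c = d.
    by move: cs; rewrite inE => /orP[/eqP//|cs]; case: nP; exists c.
  exists d; rewrite ?mem_head // -cd; split=> // c'.
  rewrite inE => /orP[/eqP->|c's Pc'].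
    by rewrite cd.
  by case: nP; exists c'.
have [e' es' [Pe' maxe']] := IHs (ex_intro2 _ _ e es Pe).
have [Pd|nPd] := pselect (P d /\ e' <= d).
  exists d; first exact: mem_head; split=> [|c']; first by case: Pd.
  rewrite inE => /orP[/eqP->//|c's Pc']; apply: le_trans (Pd.2); exact: maxe'.
exists e'; first by rewrite inE es' orbT.
split=> // c'; rewrite inE => /orP[/eqP-> Pd|]; last exact: maxe'.
by rewrite leNgt; apply/negP => /ltW ed; apply: nPd.
Qed.

Lemma Fil_bifiltration X : bifiltration (@Fil k R X).
Proof.
split; [exact: Fil0 | by move=> *; exact: FilZD |].
exists (flatten [seq [:: p.1; p.2] | p <- X]) => b v v0.
have [i vi] : exists i, v i 0 != 0.
  apply/existsP; apply: contraNT v0; rewrite negb_exists => /forallP v0.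
  apply/eqP/matrixP => i j; rewrite mxE ord1; apply/eqP.
  by have := v0 i; rewrite negbK.
(* The level of a vector is the least level occurring in its support. *)
case: (@Order.TotalTheory.arg_minP _ R _ i (fun i => v i 0 != 0)
  (fun i => lev b (summand i)) vi) => j vj jmin.
exists (lev b (summand j)) => [|c'].
  apply/flatten_mapP; exists (summand j); first exact: mem_tnth.
  by rewrite /lev !inE; case: b {jmin}; rewrite eqxx ?orbT.
split=> [/(_ j vj)//|cj l /jmin]; exact: le_trans.
Qed.

Lemma bifiltration_le n (G : bool -> R -> 'cV[k]_n -> Prop) b c c' v :
  bifiltration G -> c' <= c -> G b c v -> G b c' v.
Proof.
move=> [G0 _ [s sP]] cc; have [->|/(sP b)[d _ dP]] := eqVneq v 0; first by [].
by move=> /dP cd; apply/dP/(le_trans cc).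
Qed.

Lemma bifiltration_pull m n (G : bool -> R -> 'cV[k]_m -> Prop)
    (J : 'M[k]_(m, n)) :
  bifiltration G -> (forall v : 'cV_n, J *m v = 0 -> v = 0) ->
  bifiltration (fun b c v => G b c (J *m v)).
Proof.
move=> [G0 GZD [s sP]] Jinj; split=> [b c|b c a u v Gu Gv|].
- by rewrite mulmx0.
- by rewrite mulmxDr -scalemxAr; apply: GZD.
- exists s => b v v0; apply: sP; apply: contraNneq v0 => /Jinj ->; exact: eqxx.
Qed.

(** The level of [w] is the largest level of a preimage; the maximum is attained because all levels
    lie in the finite list [s]. *)
Lemma bifiltration_push m n (G : bool -> R -> 'cV[k]_m -> Prop)
    (Q : 'M[k]_(n, m)) :
  bifiltration G -> (forall w : 'cV_n, exists v, Q *m v = w) ->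
  bifiltration (fun b c w => exists2 v, G b c v & Q *m v = w).
Proof.
move=> [G0 GZD [s sP]] Qsurj; split=> [b c|b c a _ _ [u Gu <-] [v Gv <-]|].
- by exists 0; rewrite ?mulmx0.
- by exists (a *: u + v); rewrite ?mulmxDr -?scalemxAr //; apply: GZD.
exists s => b w w0.
have nz v : Q *m v = w -> v != 0.
  by apply: contra_eqN => /eqP ->; rewrite mulmx0 eq_sym.
have [c cs [[v Gv vw] cmax]] := @seq_argmax s
  (fun c => exists2 v, G b c v & Q *m v = w) ltac:(
    have [v vw] := Qsurj w; have [c cs cP] := sP b v (nz v vw);
    by exists c => //; exists v => //; apply/cP).
exists c => // c'; split=> [[v' Gv' v'w]|c'c].
  have [d ds dP] := sP b v' (nz v' v'w).
  apply: (@le_trans _ _ d); first exact/dP.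
  by apply: cmax => //; exists v' => //; apply/dP.
have [d ds dP] := sP b v (nz v vw).
by exists v => //; apply/dP; apply: (le_trans c'c); apply/dP.
Qed.

(* Split off a vector [w] of maximal second level: every lift along the
   quotient by [w] of a vector has the same second level, so adapted basis
   vectors of the quotient only need to be lifted for the first filtration. *)
Lemma adapted_basis n (G : bool -> R -> 'cV[k]_n -> Prop) :
  bifiltration G ->
  exists X (M : 'M[k]_(n, size X)),
    (forall v : 'cV_n, exists a, M *m a = v) /\
    (forall b c a, G b c (M *m a) <-> Fil b c a).
Proof.
have [N] := ubnP n; elim: N n G => // N IHN n G /ltnSE-nN bG.
have [G0 GZD [s sP]] := bG.
have [[w0 w0n]|nw] := pselect (exists w : 'cV[k]_n, w != 0); last first.
  have v0 (v : 'cV[k]_n) : v = 0 by apply: contra_notP nw => /eqP; exists v.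
  exists [::], 0; split=> [v|b c a]; first by exists 0; rewrite mulmx0 (v0 v).
  by rewrite (v0 (_ *m _)); split=> // _ [].
have [c0 c0s [[w wn Gw] c0max]] := @seq_argmax s
  (fun c => exists2 w, w != 0 & G false c w) ltac:(
    have [c cs cP] := sP false _ w0n;
    by exists c => //; exists w0 => //; apply/cP).
have {c0max} wtop c z : G false c z -> z != 0 -> G false c w.
  move=> Gz zn; have [d ds dP] := sP false _ zn.
  apply: (bifiltration_le bG _ Gw); apply: (@le_trans _ _ d); first exact/dP.
  by apply: c0max => //; exists z => //; apply/dP.
have [d [Q [dE Qsurj Qker]]] := mulmx_cokernel w.
have Qw : Q *m w = 0 by apply/Qker; exists 1%:M; rewrite mulmx1.
have kerQ v : Q *m v = 0 -> exists a, v = a *: w.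
  move/Qker => [u <-]; exists (u 0 0).
  by rewrite [u]mx11_scalar mul_mx_scalar mxE mulr1n.
have dn : (d < n)%N.
  have rw0 : (0 < \rank w)%N by rewrite lt0n mxrank_eq0.
  by rewrite dE ltn_subrL rw0 (leq_trans rw0) ?rank_leq_row.
have [X [M [Msurj MG]]] :=
  IHN _ _ (leq_trans dn nN) (bifiltration_push bG Qsurj).
(* The lifts are chosen for the first filtration only. *)
have liftx (i : 'I_(size X)) : exists u,
    G true (lev true (summand i)) u /\ Q *m u = M *m delta_mx i 0.
  by have [u Gu uE] := (MG _ _ _).2 (Fil_delta i true); exists u.
have [u uP] := fin_all_exists liftx.
pose L := \matrix_(i < n, j < size X) u j i 0.
have LE (a : 'cV_(size X)) : L *m a = \sum_j a j 0 *: u j.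
  apply/matrixP => i j; rewrite mxE summxE ord1; apply: eq_bigr => l _.
  by rewrite !mxE mulrC.
have QL (a : 'cV_(size X)) : Q *m (L *m a) = M *m a.
  rewrite LE mulmx_sumr [a in RHS](_ : _ = \sum_j a j 0 *: delta_mx j 0).
    rewrite mulmx_sumr; apply: eq_bigr => j _.
    by rewrite -!scalemxAr (uP j).2.
  by rewrite {1}[a]matrix_sum_delta; apply: eq_bigr => j _; rewrite big_ord1.
(* For the second filtration, [u j] differs from a lift [z] of the right level by a multiple of [w],
   whose level is at least that of [z]. *)
have uG b j : G b (lev b (summand j)) (u j).
  case: b; first exact: (uP j).1.
  have [z Gz zE] := (MG _ _ _).2 (Fil_delta j false).
  have [t zt] : exists t, u j - z = t *: w.
    by apply: kerQ; rewrite mulmxBr zE (uP j).2 subrr.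
  have -> : u j = t *: w + z by rewrite -zt subrK.
  apply: GZD => //; apply: wtop Gz _; apply: contraTneq isT => z0.
  (* If [z] were 0, the image of the basis vector would be 0 and would lie in every step, in
     particular in one above the level of that vector. *)
  have : Fil true (lev true (summand j) + 1) (delta_mx j 0 : 'cV[k]_(size X)).
    apply/MG; exists 0; rewrite ?mulmx0 -?zE ?z0 ?mulmx0 //.
  move=> /(_ j); rewrite mxE !eqxx oner_eq0 => /(_ isT).
  by rewrite -lerBrDl subrr ler10.
have [x xP] : exists x, forall b c, G b c w <-> c <= lev b x.
  have [x1 _ x1P] := sP true _ wn; have [x2 _ x2P] := sP false _ wn.
  by exists (x1, x2) => -[].
have ME (t : 'cV_1) (a : 'cV_(size X)) :
    (row_mx w L : 'M_(n, size (x :: X))) *m (col_mx t a : 'cV_(size (x :: X))) =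
    t 0 0 *: w + L *m a.
  apply: etrans (mul_row_col w L t a) _.
  by rewrite [t in LHS]mx11_scalar mul_mx_scalar.
exists (x :: X), (row_mx w L); split=> [v|b c a].
  have [a aE] := Msurj (Q *m v).
  have [t tE] : exists t, v - L *m a = t *: w.
    by apply: kerQ; rewrite mulmxBr QL aE subrr.
  by exists (col_mx t%:M a : 'cV_(1 + size X)); rewrite ME mxE mulr1n -tE subrK.
have [t [a' ->]] : exists t (a' : 'cV_(size X)),
    a = col_mx t a' :> 'cV_(1 + size X).
  exists (usubmx (a : 'cV_(1 + size X))), (dsubmx (a : 'cV_(1 + size X))).
  by rewrite vsubmxK.
rewrite ME.
have FilE : Fil b c (col_mx t a' : 'cV_(size (x :: X))) <->
    (t 0 0 != 0 -> c <= lev b x) /\ Fil b c a'.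
  have sr (i : 'I_(size X)) :
      summand (rshift 1 i : 'I_(size (x :: X))) = summand i.
    by rewrite /summand !(tnth_nth x).
  have sl : summand (lshift (size X) (0 : 'I_1) : 'I_(size (x :: X))) = x.
    by rewrite /summand (tnth_nth x).
  set V : 'cV_(size (x :: X)) := col_mx t a'.
  have Vl : V (lshift (size X) (0 : 'I_1)) 0 = t 0 0 by exact: col_mxEu.
  have Vr i : V (rshift 1 i) 0 = a' i 0 by exact: col_mxEd.
  split=> [F|[Ft Fa] i].
    split=> [tn|i an].
      by rewrite -sl; apply: F; rewrite Vl.
    by rewrite -sr; apply: F; rewrite Vr.
  case: (@split_ordP 1 (size X) i) => j ->.
    by rewrite ord1 Vl sl.
  by rewrite Vr sr; apply: Fa.
have GL : Fil b c a' -> G b c (L *m a').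
  move=> Fa; rewrite LE; elim/big_ind: _ => [|u1 u2|j _]; first exact: G0.
    by move=> Gu1 Gu2; rewrite -[u1]scale1r; apply: GZD.
  have [->|/Fa aj] := eqVneq (a' j 0) 0; first by rewrite scale0r.
  by rewrite -[_ *: _]addr0; apply: GZD => //; apply: bifiltration_le (uG b j).
rewrite FilE; split=> [GM|[tx Fa]]; last first.
  have [->|/tx/xP] := eqVneq (t 0 0) 0.
    by rewrite scale0r add0r; apply: GL.
  by move=> Gw'; apply: GZD => //; apply: GL.
(* [Q] kills [w], so the image of the vector in the quotient determines the levels of [a']. *)
have Fa : Fil b c a'.
  apply/MG; exists (t 0 0 *: w + L *m a') => //.
  by rewrite mulmxDr -scalemxAr Qw scaler0 add0r QL.
split=> // tn; apply/xP.
(* Both the whole vector and its part [L *m a'] lie in the step, hence so does [w]. *)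
have -> : w = (t 0 0)^-1 *: (t 0 0 *: w + L *m a' - L *m a') + 0.
  by rewrite addrK addr0 scalerA mulVf ?scale1r.
by apply: (GZD) => //; rewrite addrC -scaleN1r; apply: GZD => //; apply: GL.
Qed.

(** An adapted basis turns the kernel, with the filtrations pulled back from [Y], into an object of
    B; strictness holds by the choice of these filtrations. *)
Lemma strict_kernel Y m (A : 'M[k]_(m, size Y)) :
  exists X (f : Bhom k X Y), strict_mono (Bmx f) /\ middle_exact (Bmx f) A.
Proof.
have [d [J [Jinj Jker]]] := mulmx_kernel A.
have [X [M [Msurj MF]]] :=
  adapted_basis (bifiltration_pull (Fil_bifiltration Y) Jinj).
have FJM b c a : Fil b c (J *m M *m a) <-> Fil b c a by rewrite -mulmxA.
have [f fE] : exists f : Bhom k X Y, Bmx f = J *m M.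
  by apply: filtered_Bhom => b c a /FJM.
exists X, f; rewrite fE; split=> [b c a /FJM//|y].
rewrite Jker; split=> [[v <-]|[a <-]]; last by exists (M *m a); rewrite mulmxA.
by have [a <-] := Msurj v; exists a; rewrite mulmxA.
Qed.

(** Dual construction, with the image filtrations on the quotient. The morphism is the projection
    [Q] written in the adapted basis [M]. *)
Lemma strict_cokernel Y m (A : 'M[k]_(size Y, m)) :
  exists Z (g : Bhom k Y Z), strict_epi (Bmx g) /\ middle_exact A (Bmx g).
Proof.
have [d [Q [_ Qsurj Qker]]] := mulmx_cokernel A.
have [Z [M [Msurj MF]]] :=
  adapted_basis (bifiltration_push (Fil_bifiltration Y) Qsurj).
(* A vector killed by [M] lies in every step, since 0 does. *)
have Minj (a a' : 'cV_(size Z)) : M *m a = M *m a' -> a = a'.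
  move=> /eqP; rewrite -subr_eq0 -mulmxBr => /eqP Ma.
  have [c cP] := @Fil_upper_bound k R Z true.
  apply/eqP; rewrite -subr_eq0; apply/eqP/cP/MF; exists 0; first exact: Fil0.
  by rewrite mulmx0 Ma.
have [N NE] : exists N, M *m N = Q.
  by apply: mulmx_lift => v; exact: Msurj.
have [g gE] : exists g : Bhom k Y Z, Bmx g = N.
  apply: filtered_Bhom => b c y Fy; apply/MF; exists y => //.
  by rewrite mulmxA NE.
exists Z, g; rewrite gE; split=> [b c z /MF[y Fy yE]|y].
  by exists y => //; apply: Minj; rewrite mulmxA NE.
rewrite -Qker -NE -mulmxA; split=> [->|My]; first by rewrite mulmx0.
by apply: Minj; rewrite mulmx0.
Qed.

End AdaptedBases.

(** * Factorization through strict maps, and biproducts *)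

Section Homs.
Variables (k : fieldType) (R : realType).
Implicit Types (X Y Z W : Bob R) (b : bool) (c : R).

Lemma Bmx_inj X Y : injective (@Bmx k R X Y).
Proof. exact: val_inj. Qed.

(** A linear factorization exists by exactness, and strictness of [f] makes it filtered. *)
Lemma strict_mono_factor X Y W m (f : Bhom k X Y) (A : 'M[k]_(m, size Y))
    (h : Bhom k W Y) :
  strict_mono (Bmx f) -> middle_exact (Bmx f) A -> A *m Bmx h = 0 ->
  exists h' : Bhom k W X, Bmx f *m Bmx h' = Bmx h.
Proof.
move=> fm fA Ah.
have [D DE] : exists D, Bmx f *m D = Bmx h.
  by apply: mulmx_lift => v; apply/fA; rewrite mulmxA Ah mul0mx.
have [h' h'E] : exists h' : Bhom k W X, Bmx h' = D.
  apply: filtered_Bhom => b c v Fv; apply: fm.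
  by rewrite mulmxA DE; apply: Bhom_filtered.
by exists h'; rewrite h'E.
Qed.

Lemma strict_mono_monic X Y W (f : 'M[k]_(size Y, size X)) (h h' : Bhom k W X) :
  strict_mono f -> f *m Bmx h = f *m Bmx h' -> h = h'.
Proof.
move=> fm fh; apply/Bmx_inj/mulmx_inj => v; apply/eqP; rewrite -subr_eq0.
by apply/eqP/(strict_mono_inj fm); rewrite mulmxBr !mulmxA fh subrr.
Qed.

Lemma strict_epi_factor Y Z W n (g : Bhom k Y Z) (A : 'M[k]_(size Y, n))
    (h : Bhom k Y W) :
  strict_epi (Bmx g) -> middle_exact A (Bmx g) -> Bmx h *m A = 0 ->
  exists h' : Bhom k Z W, Bmx h' *m Bmx g = Bmx h.
Proof.
move=> ge gA hA.
(* The section [S] is only linear. Still [h S] is filtered: a vector of a step lifts along [g]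
   within the step, and [h S g = h]. *)
have [S SE] : exists S, Bmx g *m S = 1%:M.
  by apply: mulmx_lift => v; rewrite mul1mx; apply: strict_epi_surj.
have hSg : Bmx h *m S *m Bmx g = Bmx h.
  apply: mulmx_inj => y; apply/eqP.
  rewrite -subr_eq0 -!mulmxA -mulmxBr; apply/eqP.
  have [|u uE] := (gA (S *m (Bmx g *m y) - y)).1.
    by rewrite mulmxBr !mulmxA SE mul1mx subrr.
  by rewrite -uE mulmxA hA mul0mx.
have [h' h'E] : exists h' : Bhom k Z W, Bmx h' = Bmx h *m S.
  apply: filtered_Bhom => b c z /ge[y Fy <-].
  by rewrite mulmxA hSg; apply: Bhom_filtered.
by exists h'; rewrite h'E.
Qed.

Lemma strict_epi_epic Y Z W (g : 'M[k]_(size Z, size Y)) (h h' : Bhom k Z W) :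
  strict_epi g -> Bmx h *m g = Bmx h' *m g -> h = h'.
Proof.
move=> ge hg; apply/Bmx_inj/mulmx_inj => v; have [y <-] := strict_epi_surj v ge.
by rewrite !mulmxA hg.
Qed.

Lemma strict_mono_comp X Y Z (f : 'M[k]_(size Y, size X))
    (g : 'M[k]_(size Z, size Y)) :
  strict_mono f -> strict_mono g -> strict_mono (g *m f).
Proof. by move=> fm gm b c a; rewrite -mulmxA => /gm/fm. Qed.

Lemma strict_epi_comp X Y Z (f : 'M[k]_(size Y, size X))
    (g : 'M[k]_(size Z, size Y)) :
  strict_epi f -> strict_epi g -> strict_epi (g *m f).
Proof.
move=> fe ge b c z /ge[y /fe[x Fx <-] <-].
by exists x; rewrite ?mulmxA.
Qed.

(** The structure maps of biproducts, the hull, and the two summands of the cover are all of this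
    form. *)
Definition select_mx m n (phi : 'I_m -> option 'I_n) : 'M[k]_(m, n) :=
  \matrix_(j, i) (phi j == Some i)%:R.

Lemma select_mxE m n (phi : 'I_m -> option 'I_n) (v : 'cV_n) j :
  (select_mx phi *m v) j 0 = if phi j is Some i then v i 0 else 0.
Proof.
rewrite mxE; case E : (phi j) => [i|].
  rewrite (bigD1 i) //= big1 ?addr0 ?mxE ?E ?eqxx ?mul1r // => l li.
  by rewrite mxE E (inj_eq Some_inj) eq_sym (negPf li) mul0r.
by rewrite big1 // => l _; rewrite mxE E mul0r.
Qed.

Lemma select_Bhom X Y (phi : 'I_(size Y) -> option 'I_(size X)) :
  (forall j i, phi j = Some i -> leM (summand i) (summand j)) ->
  exists f : Bhom k X Y, Bmx f = select_mx phi.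
Proof.
move=> le_phi; have sB : select_mx phi \in @Bhom_pred k R X Y.
  by apply/Bhom_predP => j i; rewrite mxE; case: eqP => // /le_phi ->.
by exists (BHom sB).
Qed.

(** Objects can then be indexed by sums and products of ordinals, without arithmetic on positions in
    lists. *)
Lemma indexed_object (T : finType) (l : T -> R * R) :
  exists X (e : 'I_(size X) -> T) (d : T -> 'I_(size X)),
    [/\ cancel e d, cancel d e, forall i, summand i = l (e i)
      & forall t, summand (d t) = l t].
Proof.
have sz : #|T| = size [seq l t | t <- enum T] by rewrite size_map -cardE.
exists [seq l t | t <- enum T], (fun i => enum_val (cast_ord (esym sz) i)),
  (fun t => cast_ord sz (enum_rank t)).
have dK : cancel (fun t => cast_ord sz (enum_rank t))
    (fun i => enum_val (cast_ord (esym sz) i)).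
  by move=> t; rewrite cast_ordK enum_rankK.
have lE i : @summand R [seq l t | t <- enum T] i =
    l (enum_val (cast_ord (esym sz) i)).
  have t0 : T := enum_val (cast_ord (esym sz) i).
  rewrite /summand (tnth_nth (l t0)) (nth_map t0); last first.
    by rewrite -cardE sz ltn_ord.
  by rewrite (enum_val_nth t0).
split=> // [i|t]; first by rewrite enum_valK cast_ordKV.
by rewrite lE dK.
Qed.

Lemma exists_biproduct X Y :
  exists S (i1 : Bhom k X S) (i2 : Bhom k Y S) (p1 : Bhom k S X)
      (p2 : Bhom k S Y),
    [/\ Bmx p1 *m Bmx i1 = 1%:M, Bmx p2 *m Bmx i2 = 1%:M,
      Bmx p1 *m Bmx i2 = 0, Bmx p2 *m Bmx i1 = 0
      & Bmx i1 *m Bmx p1 + Bmx i2 *m Bmx p2 = 1%:M].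
Proof.
have [S [e [d [ed de se sd]]]] := indexed_object
  (fun t : 'I_(size X) + 'I_(size Y) =>
     match t with inl i => summand i | inr j => summand j end).
have [s|i1 i1E] :=
    @select_Bhom X S (fun s => if e s is inl i then Some i else None).
  by rewrite se; case: (e s) => // i _ [<-]; apply: leM_refl.
have [s|i2 i2E] :=
    @select_Bhom Y S (fun s => if e s is inr i then Some i else None).
  by rewrite se; case: (e s) => // i _ [<-]; apply: leM_refl.
have [i _ [<-]|p1 p1E] := @select_Bhom S X (fun i => Some (d (inl i))).
  by rewrite sd; apply: leM_refl.
have [i _ [<-]|p2 p2E] := @select_Bhom S Y (fun i => Some (d (inr i))).
  by rewrite sd; apply: leM_refl.
exists S, i1, i2, p1, p2; rewrite i1E i2E p1E p2E.
split; apply: mulmx_inj => v; apply/matrixP => i z; rewrite ord1 {z}.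
- by rewrite -mulmxA mul1mx !select_mxE de.
- by rewrite -mulmxA mul1mx !select_mxE de.
- by rewrite -mulmxA mul0mx !select_mxE de mxE.
- by rewrite -mulmxA mul0mx !select_mxE de mxE.
- rewrite mulmxDl -!mulmxA mul1mx mxE !select_mxE.
  by case E : (e i) => [j|j]; rewrite !select_mxE -E ed ?addr0 ?add0r.
Qed.

(** * The bound [|y - x| <= r] under strict maps and biproducts *)

Variable r : R.

Lemma in_B_le_summand X :
  in_B_le (k := k) r X <->
  forall i : 'I_(size X), `|(summand i).2 - (summand i).1| <= r.
Proof.
split=> [/(all_tnthP (t := in_tuple X))//|h].
exact/(all_tnthP (t := in_tuple X)).
Qed.

(** This basis-free form is what strict subobjects and quotients inherit, as their adapted bases
    need not come from the given summands. *)
Lemma in_B_leP X :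
  in_B_le (k := k) r X <->
  forall b c (v : 'cV[k]_(size X)), Fil b c v -> Fil (~~ b) (c - r) v.
Proof.
rewrite in_B_le_summand; split=> [h b c v Fv i /Fv|h i].
  move: (h i); rewrite ler_norml /lev; case: b {Fv} => /=; lra.
have nz : (delta_mx i 0 : 'cV[k]_(size X)) i 0 != 0.
  by rewrite mxE !eqxx oner_neq0.
have := h true _ _ (Fil_delta i true) i nz.
have := h false _ _ (Fil_delta i false) i nz.
by rewrite ler_norml /lev /=; lra.
Qed.

Lemma in_B_le_sub X Y (f : Bhom k X Y) :
  strict_mono (Bmx f) -> in_B_le (k := k) r Y -> in_B_le (k := k) r X.
Proof.
move=> fm /in_B_leP rY; apply/in_B_leP => b c v Fv; apply/fm/rY.
exact: Bhom_filtered.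
Qed.

Lemma in_B_le_quot X Y (g : Bhom k X Y) :
  strict_epi (Bmx g) -> in_B_le (k := k) r X -> in_B_le (k := k) r Y.
Proof.
move=> ge /in_B_leP rX; apply/in_B_leP => b c _ /ge[y Fy <-].
exact/Bhom_filtered/rX.
Qed.

Lemma in_B_le_biproduct X Y S (i1 : Bhom k X S) (i2 : Bhom k Y S)
    (p1 : Bhom k S X) (p2 : Bhom k S Y) :
  Bmx i1 *m Bmx p1 + Bmx i2 *m Bmx p2 = 1%:M ->
  in_B_le (k := k) r X -> in_B_le (k := k) r Y -> in_B_le (k := k) r S.
Proof.
move=> id12 /in_B_leP rX /in_B_leP rY; apply/in_B_leP => b c v Fv.
rewrite -[v]mul1mx -id12 mulmxDl -!mulmxA -[Bmx i1 *m _]scale1r.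
apply: FilZD; apply: Bhom_filtered; [apply: rX|apply: rY];
  exact: Bhom_filtered.
Qed.

End Homs.

(** * The exact structure *)

Section ExactStructure.
Variables (k : fieldType) (R : realType) (r : R).
Local Notation C := (B_le k r).
Local Notation E := (B_le_exact (k := k) (r := r)).
Implicit Types X Y Z W : C.

Definition le_mx X Y (f : mor X Y) : 'M[k]_(size (sval Y), size (sval X)) :=
  Bmx (f : Bhom k (sval X) (sval Y)).

Lemma le_mx_inj X Y : injective (@le_mx X Y).
Proof. exact: Bmx_inj. Qed.

Lemma le_mx_cmp X Y Z (g : mor Y Z) (f : mor X Y) :
  le_mx (cmp g f) = le_mx g *m le_mx f.
Proof. by []. Qed.

Lemma le_mx_id X : le_mx (idm X) = 1%:M.
Proof. by []. Qed.

Lemma le_mx0 X Y : le_mx (0 : mor X Y) = 0.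
Proof. by []. Qed.

Lemma le_mxD X Y (f g : mor X Y) : le_mx (f + g) = le_mx f + le_mx g.
Proof. by []. Qed.

Definition le_mxE := (le_mx_cmp, le_mx_id, le_mx0, le_mxD).

Lemma le_mx_filtered X Y (f : mor X Y) : filtered (le_mx f).
Proof. exact: Bhom_filtered. Qed.

Global Arguments le_mx_filtered {X Y} f [b c a].

Lemma B_le_exactP X Y Z (f : mor X Y) (g : mor Y Z) :
  E f g <-> [/\ strict_mono (le_mx f), strict_epi (le_mx g)
    & middle_exact (le_mx f) (le_mx g)].
Proof. exact: B_exactP. Qed.

Lemma B_le_kernel Y m (A : 'M[k]_(m, size (sval Y))) :
  exists X (f : mor X Y), strict_mono (le_mx f) /\ middle_exact (le_mx f) A.
Proof.
have [X [f [fm fA]]] := strict_kernel A.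
by exists (exist _ X (in_B_le_sub fm (svalP Y))), f.
Qed.

Lemma B_le_cokernel Y m (A : 'M[k]_(size (sval Y), m)) :
  exists Z (g : mor Y Z), strict_epi (le_mx g) /\ middle_exact A (le_mx g).
Proof.
have [Z [g [ge gA]]] := strict_cokernel A.
by exists (exist _ Z (in_B_le_quot ge (svalP Y))), g.
Qed.

(** The strict cokernel completes a strict monomorphism to an exact sequence, and as a strict
    quotient of [Y] it satisfies the bound. *)
Lemma inflationP X Y (f : mor X Y) : inflation E f <-> strict_mono (le_mx f).
Proof.
split=> [[Z [g /B_le_exactP[]]]//|fm].
have [Z [g [ge fg]]] := B_le_cokernel (le_mx f).
by exists Z, g; apply/B_le_exactP.
Qed.

Lemma deflationP Y Z (g : mor Y Z) : deflation E g <-> strict_epi (le_mx g).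
Proof.
split=> [[X [f /B_le_exactP[]]]//|ge].
have [X [f [fm fg]]] := B_le_kernel (le_mx g).
by exists X, f; apply/B_le_exactP.
Qed.

Lemma B_le_biproduct X Y :
  exists S (i1 : mor X S) (i2 : mor Y S) (p1 : mor S X) (p2 : mor S Y),
    is_biproduct i1 i2 p1 p2.
Proof.
have [S [i1 [i2 [p1 [p2 [h1 h2 h3 h4 h5]]]]]] :=
  exists_biproduct k (sval X) (sval Y).
exists (exist _ S (in_B_le_biproduct h5 (svalP X) (svalP Y))), i1, i2, p1, p2.
by split; apply: le_mx_inj; rewrite !le_mxE.
Qed.

Lemma B_le_additive : additive_category C.
Proof.
split; last exact: B_le_biproduct.
exists (exist _ [::] isT); split=> X f g; apply/le_mx_inj/matrixP => i j.
  by case: j.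
by case: i.
Qed.

Lemma exact_is_kernel X Y Z (f : mor X Y) (g : mor Y Z) :
  E f g -> is_kernel f g.
Proof.
case/B_le_exactP => fm ge fg; split.
  apply/le_mx_inj/mulmx_inj => v; rewrite !le_mxE mul0mx -mulmxA.
  by apply/fg; exists v.
move=> W h /(congr1 (@le_mx _ _)); rewrite !le_mxE => gh.
have [h' h'E] := strict_mono_factor fm fg gh.
exists h'; split=> [|h'' h''E]; first exact: le_mx_inj.
apply: (strict_mono_monic fm); apply: etrans h'E _; symmetry.
exact: (congr1 (@le_mx _ _) h''E).
Qed.

Lemma exact_is_cokernel X Y Z (f : mor X Y) (g : mor Y Z) :
  E f g -> is_cokernel f g.
Proof.
case/B_le_exactP => fm ge fg; split.
  apply/le_mx_inj/mulmx_inj => v; rewrite !le_mxE mul0mx -mulmxA.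
  by apply/fg; exists v.
move=> W h /(congr1 (@le_mx _ _)); rewrite !le_mxE => gh.
have [h' h'E] := strict_epi_factor ge fg gh.
exists h'; split=> [|h'' h''E]; first exact: le_mx_inj.
apply: (strict_epi_epic ge); apply: etrans h'E _; symmetry.
exact: (congr1 (@le_mx _ _) h''E).
Qed.

Lemma B_le_pullback Y Z Z' (p : mor Y Z) (u : mor Z' Z) :
  deflation E p -> exists Y' (u' : mor Y' Y) (p' : mor Y' Z'),
    is_pullback p u u' p' /\ deflation E p'.
Proof.
move=> /deflationP pe.
have [S [i1 [i2 [p1 [p2 [p1i1 p2i2 p1i2 p2i1 ip]]]]]] := B_le_biproduct Y Z'.
(* The pullback is the kernel of [(p, - u)] on the biproduct of [Y] and [Z']. *)
pose A := le_mx p *m le_mx p1 - le_mx u *m le_mx p2.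
have [K [j [jm jA]]] := B_le_kernel A.
have AE W (a : mor W Y) (b : mor W Z') :
    A *m le_mx (cmp i1 a + cmp i2 b) = le_mx p *m le_mx a - le_mx u *m le_mx b.
  rewrite !le_mxE mulmxDr !mulmxBl -!mulmxA.
  rewrite !(mulmxA (le_mx p1)) !(mulmxA (le_mx p2)).
  rewrite -!le_mx_cmp p1i1 p2i2 p1i2 p2i1 !le_mxE !(mul1mx, mul0mx, mulmx0).
  by rewrite subr0 sub0r.
exists K, (cmp p1 j), (cmp p2 j); split; first split.
- apply/le_mx_inj/eqP; rewrite !le_mxE -subr_eq0 !mulmxA -mulmxBl; apply/eqP.
  apply: mulmx_inj => v; rewrite mul0mx -mulmxA; apply/jA.
  by exists v.
- move=> W a b pab.
  have [c cE] : exists c : mor W K, cmp j c = cmp i1 a + cmp i2 b.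
    have Ah : A *m le_mx (cmp i1 a + cmp i2 b) = 0.
      by rewrite AE -!le_mx_cmp pab subrr.
    have [c cE] := strict_mono_factor jm jA Ah; exists c; exact: le_mx_inj.
  exists c; split=> [|c' [c'a c'b]].
    rewrite -!cmpA cE; split; apply: le_mx_inj;
      rewrite !le_mxE mulmxDr !mulmxA -!le_mx_cmp.
      by rewrite p1i1 p1i2 !le_mxE mul1mx mul0mx addr0.
    by rewrite p2i1 p2i2 !le_mxE mul1mx mul0mx add0r.
  apply: (strict_mono_monic jm); apply: etrans (congr1 (@le_mx _ _) cE) _.
  rewrite -c'a -c'b !le_mxE !mulmxA -!mulmxDl.
  by have /= -> := congr1 (@le_mx _ _) ip; rewrite mul1mx.
(* A lift [y] of [u z] in the same step gives a vector [(y, z)] of the kernel; it lies in that step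
   because the kernel is strict. *)
- apply/deflationP => b c z Fz.
  have [y Fy yE] := pe _ _ _ (le_mx_filtered u Fz).
  pose s := le_mx i1 *m y + le_mx i2 *m z.
  have Fs : Fil b c s.
    rewrite /s -[le_mx i1 *m _]scale1r.
    by apply: FilZD; apply: le_mx_filtered.
  have [p1s p2s] : le_mx p1 *m s = y /\ le_mx p2 *m s = z.
    rewrite /s !mulmxDr !mulmxA -!le_mx_cmp p1i1 p1i2 p2i1 p2i2 !le_mxE.
    by rewrite !(mul1mx, mul0mx) addr0 add0r.
  have [a aE] : exists a, le_mx j *m a = s.
    by apply/jA; rewrite mulmxBl -!mulmxA p1s p2s yE subrr.
  exists a; first by apply: jm; rewrite aE.
  by rewrite le_mxE -mulmxA aE.
Qed.

Lemma B_le_pushout X Y X' (i : mor X Y) (u : mor X X') :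
  inflation E i -> exists Y' (u' : mor Y Y') (i' : mor X' Y'),
    is_pushout i u u' i' /\ inflation E i'.
Proof.
move=> /inflationP im.
have [S [i1 [i2 [p1 [p2 [p1i1 p2i2 p1i2 p2i1 ip]]]]]] := B_le_biproduct Y X'.
(* The pushout is the cokernel of [(i, - u)] into the biproduct of [Y] and [X']. *)
pose A := le_mx i1 *m le_mx i - le_mx i2 *m le_mx u.
have [Q [q [qe qA]]] := B_le_cokernel A.
have AE W (a : mor Y W) (b : mor X' W) :
    le_mx (cmp a p1 + cmp b p2) *m A = le_mx a *m le_mx i - le_mx b *m le_mx u.
  rewrite !le_mxE mulmxDl !mulmxBr -!mulmxA.
  rewrite !(mulmxA (le_mx p1)) !(mulmxA (le_mx p2)).
  rewrite -!le_mx_cmp p1i1 p2i2 p1i2 p2i1 !le_mxE !(mul1mx, mul0mx, mulmx0).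
  by rewrite subr0 sub0r.
exists Q, (cmp q i1), (cmp q i2); split; first split.
- apply/le_mx_inj/eqP; rewrite !le_mxE -subr_eq0 -!mulmxA -mulmxBr; apply/eqP.
  apply: mulmx_inj => v; rewrite mul0mx -mulmxA; apply/qA.
  by exists v.
- move=> W a b pab.
  have [c cE] : exists c : mor Q W, cmp c q = cmp a p1 + cmp b p2.
    have Ah : le_mx (cmp a p1 + cmp b p2) *m A = 0.
      by rewrite AE -!le_mx_cmp pab subrr.
    have [c cE] := strict_epi_factor qe qA Ah; exists c; exact: le_mx_inj.
  exists c; split=> [|c' [c'a c'b]].
    rewrite !cmpA cE; split; apply: le_mx_inj;
      rewrite !le_mxE mulmxDl -!mulmxA -!le_mx_cmp.
      by rewrite p1i1 p2i1 !le_mxE mulmx1 mulmx0 addr0.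
    by rewrite p1i2 p2i2 !le_mxE mulmx1 mulmx0 add0r.
  apply: (strict_epi_epic qe); apply: etrans (congr1 (@le_mx _ _) cE) _.
  rewrite -c'a -c'b !le_mxE -!mulmxA -!mulmxDr.
  by have /= -> := congr1 (@le_mx _ _) ip; rewrite mulmx1.
- apply/inflationP => b c x Fx.
  have [s Fs] := qe _ _ _ Fx; rewrite le_mxE -mulmxA => /eqP.
  rewrite eq_sym -subr_eq0 -mulmxBr => /eqP/qA[a aE].
  (* The first coordinate of [A a = i2 x - s] reads [i a = - p1 s], so [i a], and then [a] by
     strictness of [i], lie in the step. The second coordinate expresses [x] through [s] and [a]. *)
  have Fi : Fil b c (le_mx i *m a).
    have -> : le_mx i *m a = - (le_mx p1 *m s).
      have := congr1 (mulmx (le_mx p1)) aE.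
      rewrite mulmxBl mulmxBr mulmxBr !mulmxA -!le_mx_cmp p1i1 p1i2 !le_mxE.
      by rewrite mul1mx !mul0mx subr0 sub0r.
    by rewrite -sub0r; apply: FilB; [apply: Fil0|apply: le_mx_filtered].
  have -> : x = le_mx p2 *m s - le_mx u *m a.
    have := congr1 (mulmx (le_mx p2)) aE.
    rewrite mulmxBl mulmxBr mulmxBr !mulmxA -!le_mx_cmp p2i1 p2i2 !le_mxE.
    rewrite !mul1mx !mul0mx sub0r => ->.
    by rewrite addrC subrK.
  by apply: FilB; apply: le_mx_filtered => //; apply: im.
Qed.

Lemma is_iso_strict X Y (f : mor X Y) :
  is_iso f -> strict_mono (le_mx f) /\ strict_epi (le_mx f).
Proof.
case=> g [gf fg]; split=> [b c a Fa|b c z Fz].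
  have := le_mx_filtered g Fa.
  by rewrite mulmxA -le_mx_cmp gf le_mxE mul1mx.
exists (le_mx g *m z); first exact: le_mx_filtered.
by rewrite mulmxA -le_mx_cmp fg le_mxE mul1mx.
Qed.

Lemma B_le_exact_iso X Y Z X' Y' Z' (f : mor X Y) (g : mor Y Z)
    (f' : mor X' Y') (g' : mor Y' Z')
    (a : mor X X') (b : mor Y Y') (c : mor Z Z') :
  is_iso a -> is_iso b -> is_iso c ->
  cmp b f = cmp f' a -> cmp c g = cmp g' b -> E f g -> E f' g'.
Proof.
move=> /is_iso_strict[am ae] /is_iso_strict[bm be] /is_iso_strict[cm ce].
move=> /(congr1 (@le_mx _ _)) bf /(congr1 (@le_mx _ _)) cg.
rewrite !le_mxE in bf cg; case/B_le_exactP => fm ge fg.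
apply/B_le_exactP; split.
- move=> i l x; have [x0 <-] := strict_epi_surj x ae.
  rewrite mulmxA -bf -mulmxA => /bm/fm; exact: le_mx_filtered.
- move=> i l z /ce[z0 /ge[y Fy <-] <-]; exists (le_mx b *m y).
    exact: le_mx_filtered.
  by rewrite !mulmxA cg.
- move=> y; have [y0 <-] := strict_epi_surj y be.
  rewrite mulmxA -cg -mulmxA; split=> [/(strict_mono_inj cm)/fg[x <-]|[x']].
    by exists (le_mx a *m x); rewrite !mulmxA bf.
  have [x <-] := strict_epi_surj x' ae; rewrite mulmxA -bf -mulmxA => /eqP.
  rewrite -subr_eq0 -mulmxBr => /eqP/(strict_mono_inj bm)/eqP.
  rewrite subr_eq0 => /eqP fx; suff -> : le_mx g *m y0 = 0 by rewrite mulmx0.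
  by apply/fg; exists x.
Qed.

Lemma B_le_exact_category : exact_category E.
Proof.
split.
- exact: B_le_additive.
- exact: B_le_exact_iso.
- exact: exact_is_kernel.
- exact: exact_is_cokernel.
- by move=> X; apply/inflationP => b c a; rewrite le_mxE mul1mx.
- by move=> X; apply/deflationP => b c a Fa; exists a; rewrite ?le_mxE ?mul1mx.
- move=> X Y Z f g /inflationP fm /inflationP gm; apply/inflationP.
  exact: strict_mono_comp.
- move=> X Y Z f g /deflationP fe /deflationP ge; apply/deflationP.
  exact: strict_epi_comp.
- exact: B_le_pushout.
- exact: B_le_pullback.
Qed.

End ExactStructure.

(** * Projective and injective objects *)

Section ProjectiveInjective.
Variables (k : fieldType) (R : realType) (r : R).
Local Notation E := (B_le_exact (k := k) (r := r)).
Implicit Types X Y Z W : B_le k r.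

Lemma in_B_eq_summand (X : B k R) :
  in_B_eq r X <-> forall i : 'I_(size X), `|(summand i).2 - (summand i).1| = r.
Proof.
split=> [/(all_tnthP (t := in_tuple X)) h i|h]; first exact/eqP/h.
by apply/(all_tnthP (t := in_tuple X)) => i; apply/eqP/h.
Qed.

Lemma in_B_eq_le (X : B k R) : in_B_eq r X -> in_B_le r X.
Proof. by move/in_B_eq_summand => h; apply/in_B_le_summand => i; rewrite h. Qed.

(** When [|y - x| = |s|], either y = x + s or x = y + s, so one level can be taken as the base and
    the other as its shift, with a prescribed sign. Projectivity uses [s = - r], injectivity
    [s = r]. *)
Lemma in_B_eq_lev (X : B k R) (i : 'I_(size X)) (s : R) :
  in_B_eq r X -> `|s| = r ->
  exists b, lev (~~ b) (summand i) = lev b (summand i) + s.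
Proof.
move=> /in_B_eq_summand/(_ i) ri sr; move/eqP: ri; rewrite -sr eqr_norm2.
by case/orP => /eqP h; [exists true|exists false]; rewrite /= -?h; lra.
Qed.

(** It suffices to lift each generator for the one filtration whose level is the larger: the bound
    on [Y] places the lift in the other filtration at the level lowered by [r], which is the
    required one. *)
Lemma B_eq_projective X : in_B_eq r (sval X) -> projective E X.
Proof.
move=> rX Y Z p f /deflationP pe.
(* The sign of [r] is read off a summand, where [r] is an absolute value. *)
have r0 (i : 'I_(size (sval X))) : `|- r| = r.
  by have /in_B_eq_summand/(_ i) <- := rX; rewrite normrN normr_id.
have lift_col (i : 'I_(size (sval X))) : exists u : 'cV_(size (sval Y)),
    (forall b, Fil b (lev b (summand i)) u) /\
    le_mx p *m u = le_mx f *m delta_mx i 0.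
  have [b bE] := in_B_eq_lev i rX (r0 i).
  have [u Fu uE] := pe _ _ _ (le_mx_filtered f (Fil_delta i b)).
  exists u; split=> // b'; have [->//|/negPf bb'] := eqVneq b' b.
  have -> : b' = ~~ b by case: b b' bb' {bE Fu} => -[].
  rewrite bE; exact: (in_B_leP _ _ _).1 (svalP Y) _ _ _ Fu.
have [u uP] := fin_all_exists lift_col.
pose L := \matrix_(j < size (sval Y), i < size (sval X)) u i j 0.
have [g gE] : exists g : Bhom k (sval X) (sval Y), Bmx g = L.
  suff BL : L \in @Bhom_pred k R (sval X) (sval Y) by exists (BHom BL).
  apply/Bhom_predP => j i; rewrite mxE; apply: contraNeq => uij.
  by rewrite /leM ((uP i).1 true _ uij) ((uP i).1 false _ uij).
exists g; apply: le_mx_inj; rewrite le_mx_cmp [le_mx g]gE.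
apply/matrixP => j i.
have := congr1 (fun v : 'cV_(size (sval Z)) => v j 0) (uP i).2.
rewrite -colE [RHS]mxE => <-; rewrite !mxE.
by apply: eq_bigr => l _; rewrite mxE.
Qed.

(** The minimum over the support is attained; the default [c + 1] covers the empty support. *)
Lemma Fil_gt (X : B k R) b c (v : 'cV[k]_(size X)) :
  (forall l, v l 0 != 0 -> c < lev b (summand l)) ->
  exists2 c', c < c' & Fil b c' v.
Proof.
move=> vc; exists (\big[Order.min/c + 1]_(l | v l 0 != 0) lev b (summand l)).
  by apply/bigmin_gtP; split=> //; rewrite ltrDl.
by move=> l vl; apply: bigmin_le_cond.
Qed.

Lemma B_eq_injective X : in_B_eq r (sval X) -> injective_object E X.
Proof.
move=> rX Y Z i f /inflationP im.
have rr (j : 'I_(size (sval X))) : `|r| = r.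
  by have /in_B_eq_summand/(_ j) <- := rX; rewrite normr_id.
have ext_row (j : 'I_(size (sval X))) : exists w : 'rV_(size (sval Z)),
    (forall l, w 0 l != 0 -> leM (summand l) (summand j)) /\
    w *m le_mx i = row j (le_mx f).
  have [b bE] := in_B_eq_lev j rX (rr j).
  pose c := lev b (summand j).
  (* [D] keeps the coordinates of level at most [c]. The row sought must factor through [D], so
     [row j f] has to vanish on the kernel of [D i], which is spanned by the columns of [K]. *)
  pose D := diag_mx (\row_(l < size (sval Z))
    (lev b (summand l) <= c)%R%:R : 'rV[k]_(size (sval Z))).
  have /submxP[w wE] : (row j (le_mx f) <= D *m le_mx i)%MS.
    rewrite submxE; apply/eqP/matrixP => x m; rewrite ord1 [RHS]mxE {x}.
    set K := cokermx _; pose a := col m K.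
    have Dia : D *m (le_mx i *m a) = 0.
      by rewrite mulmxA /a colE (mulmxA (D *m _)) mulmx_coker mul0mx.
    (* If [D i a = 0], then [i a] lies in a step strictly above [c], hence so does [a] by
       strictness, and [f] has no component from there to the summand [j] of level [c]. *)
    have [l ial|c' cc' Fc'] := @Fil_gt (sval Z) b c (le_mx i *m a).
      rewrite ltNge; apply/negP => lc.
      have := congr1 (fun v : 'cV_(size (sval Z)) => v l 0) Dia.
      rewrite mul_diag_mx mxE [in X in X * _]mxE lc mul1r [RHS]mxE => z.
      by rewrite z eqxx in ial.
    have Fa := im _ _ _ Fc'.
    rewrite mxE big1 // => l _; rewrite mxE.
    have [->|al] := eqVneq (K l m) 0; first by rewrite mulr0.
    have c'l : c' <= lev b (summand l) by apply: Fa; rewrite mxE.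
    have [->|fjl] := eqVneq (le_mx f j l) 0; first by rewrite mul0r.
    have : (le_mx f *m delta_mx l 0 : 'cV_(size (sval X))) j 0 != 0.
      by rewrite -colE mxE.
    move/(le_mx_filtered f (Fil_delta l b)) => lj.
    by have := lt_le_trans cc' (le_trans c'l lj); rewrite ltxx.
  (* Where the new row is nonzero, one level is at most [c]; the bound on [Z] keeps the other below
     [c + r], the other level of summand [j]. *)
  exists (w *m D); split=> [l|]; last by rewrite -mulmxA -wE.
  rewrite mul_mx_diag !mxE; case: leP => [lc _|_]; last by rewrite mulr0 eqxx.
  have := (in_B_le_summand k _ _).1 (svalP Z) l; move: bE lc.
  rewrite /c ler_norml /leM; case: (b) => /= bE lc /andP[h1 h2];
    by clear -bE lc h1 h2; apply/andP; split; lra.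
have [w wP] := fin_all_exists ext_row.
have [g gE] : exists g : Bhom k (sval Z) (sval X), Bmx g = \matrix_j w j.
  suff BL : (\matrix_j w j) \in @Bhom_pred k R (sval Z) (sval X).
    by exists (BHom BL).
  apply/Bhom_predP => j l; rewrite mxE; apply: contraNeq; exact: (wP j).1.
exists g; apply: le_mx_inj; rewrite le_mx_cmp [le_mx g]gE.
by apply/row_matrixP => j; rewrite row_mul rowK (wP j).2.
Qed.

(** A diagonal entry of [p a] is 1, so some summand of [Y] has nonzero components from and to the
    given summand of [X]. By antisymmetry of [leM] the two coincide. *)
Lemma in_B_eq_retract X Y (a : mor X Y) (p : mor Y X) :
  cmp p a = idm X -> in_B_eq r (sval Y) -> in_B_eq r (sval X).
Proof.
move=> /(congr1 (@le_mx _ _ _ _ _)); rewrite le_mx_cmp le_mx_id => pa.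
move/in_B_eq_summand => rY; apply/in_B_eq_summand => i.
have [s /andP[pis asi]] : exists s, (le_mx p i s != 0) && (le_mx a s i != 0).
  apply/existsP; apply: contraT; rewrite negb_exists => /forallP pa0.
  have := congr1 (fun A : 'M_(size (sval X)) => A i i) pa.
  rewrite !mxE eqxx big1 => [/eqP|s _]; first by rewrite eq_sym oner_eq0.
  by apply/eqP; rewrite mulf_eq0; have := pa0 s; rewrite negb_and !negbK.
have le_si : leM (summand s) (summand i).
  by apply: contraNT pis => /(Bhom_predP _ (Bmx_in p)) ps; apply/eqP.
have le_is : leM (summand i) (summand s).
  by apply: contraNT asi => /(Bhom_predP _ (Bmx_in a)) ps; apply/eqP.
case/andP: le_si le_is => h1 h2 /andP[h3 h4]; apply: etrans (rY s).
by congr (`|_ - _|); apply/eqP; rewrite eq_le ?h1 ?h2 ?h3 ?h4.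
Qed.

(** Each M(x, y) contributes M(x, x + s) and M(y + s, y). For [s = - r] this is the projective cover
    term, for [s = r] the injective hull term; the boolean tells which level is kept. *)
Lemma shifted_object (s : R) (X : B k R) : `|s| = r ->
  exists (P : B k R) (e : 'I_(size P) -> 'I_(size X) * bool)
      (d : 'I_(size X) * bool -> 'I_(size P)),
    [/\ in_B_eq r P, cancel e d, cancel d e &
      forall t, lev t.2 (summand (d t)) = lev t.2 (summand t.1) /\
        lev (~~ t.2) (summand (d t)) = lev t.2 (summand t.1) + s].
Proof.
move=> sr; have [P [e [d [ed de Pe Pd]]]] := indexed_object
  (fun t : 'I_(size X) * bool =>
  let p := summand t.1 in if t.2 then (p.1, p.1 + s) else (p.2 + s, p.2)).
exists P, e, d; split=> //.
  apply/in_B_eq_summand => i; rewrite Pe -sr; case: (e i) => j [] /=.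
    by rewrite addrC addKr.
  by rewrite opprD addNKr normrN.
by move=> [j []]; rewrite !Pd.
Qed.

Hypothesis r_ge0 : 0 <= r.

Lemma B_eq_cover Z :
  exists P (p : mor P Z), in_B_eq r (sval P) /\ deflation E p.
Proof.
have [P [e [d [rP ed de Pd]]]] := @shifted_object (- r) (sval Z)
  (etrans (normrN r) (ger0_norm r_ge0)).
have rZ := (in_B_le_summand k _ _).1 (svalP Z).
have le_d i b : leM (summand (d (i, b))) (summand i).
  have := rZ i; have [] := Pd (i, b); rewrite ler_norml /leM.
  by case: b => /= h1 h2 /andP[h3 h4]; apply/andP; split; lra.
have [j _ [<-]|p1 p1E] :=
    @select_Bhom k R P (sval Z) (fun i => Some (d (i, true))).
  exact: le_d.
have [j _ [<-]|p2 p2E] :=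
    @select_Bhom k R P (sval Z) (fun i => Some (d (i, false))).
  exact: le_d.
exists (exist _ P (in_B_eq_le rP)), (p1 + p2 : Bhom k P (sval Z)); split=> //.
apply/deflationP => b c z Fz.
(* The lift is placed in the copies that keep the level [b], so it lies in the same step as [z]. *)
pose y : 'cV[k]_(size P) := \col_j (if (e j).2 == b then z (e j).1 0 else 0).
exists y.
  move=> j; rewrite mxE; case: ((e j).2 =P b) => [eb|]; last by rewrite eqxx.
  by move/Fz => ci; have [] := Pd (e j); rewrite ed eb => ->.
apply/matrixP => i x; rewrite ord1 [le_mx _]/(Bmx p1 + Bmx p2) p1E p2E.
rewrite mulmxDl mxE !select_mxE.
by rewrite !mxE !de; case: (b) => /=; rewrite ?addr0 ?add0r.
Qed.

Lemma B_eq_hull X :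
  exists I (i : mor X I), in_B_eq r (sval I) /\ inflation E i.
Proof.
have [I [e [d [rI ed de Id]]]] := @shifted_object r (sval X) (ger0_norm r_ge0).
have rX := (in_B_le_summand k _ _).1 (svalP X).
have [j _ [<-]|i iE] := @select_Bhom k R (sval X) I (fun j => Some (e j).1).
  have := rX (e j).1; have [] := Id (e j); rewrite ed ler_norml /leM.
  by case: (e j) => l [] /= h1 h2 /andP[h3 h4]; apply/andP; split; lra.
exists (exist _ I (in_B_eq_le rI)), i; split=> //.
(* The map is diagonal, and the copy [(j, b)] detects the level [b] of summand [j]. *)
apply/inflationP => b c v Fv j vj; have [<- _] := Id (j, b).
by apply: Fv; rewrite [le_mx _]iE select_mxE de.
Qed.

(** The cover of a projective object splits, which makes the object a retract of one in B_r. *)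
Lemma B_eq_projectiveE X : projective E X <-> in_B_eq r (sval X).
Proof.
split=> [Xproj|]; last exact: B_eq_projective.
have [P [p [rP pd]]] := B_eq_cover X.
by have [a pa] := Xproj _ _ p (idm X) pd; apply: in_B_eq_retract pa rP.
Qed.

Lemma B_eq_injectiveE X : injective_object E X <-> in_B_eq r (sval X).
Proof.
split=> [Xinj|]; last exact: B_eq_injective.
have [I [i [rI ii]]] := B_eq_hull X.
by have [p pi] := Xinj _ _ i (idm X) ii; apply: in_B_eq_retract pi rI.
Qed.

Lemma B_le_frobenius : frobenius_category E.
Proof.
split; first exact: B_le_exact_category.
- move=> Z; have [P [p [rP pd]]] := B_eq_cover Z; exists P, p.
  by split=> //; apply: B_eq_projective.
- move=> X; have [I [i [rI ii]]] := B_eq_hull X; exists I, i.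
  by split=> //; apply: B_eq_injective.
- by move=> X; rewrite B_eq_projectiveE B_eq_injectiveE.
Qed.

End ProjectiveInjective.

Theorem theorem1p4p5 (k : fieldType) (R : realType) (r : R) (r_gt0 : 0 < r) :
  frobenius_category (B_le_exact (k := k) (r := r)) /\
  (forall X : B k R,
     in_B_eq r X <->
     exists hX : in_B_le r X,
       projective (B_le_exact (r := r)) (exist _ X hX) /\
       injective_object (B_le_exact (r := r)) (exist _ X hX)).
Proof.
split; first exact/B_le_frobenius/ltW.
move=> X; split=> [rX|[hX [/(B_eq_projectiveE (ltW r_gt0))//]]].
exists (in_B_eq_le rX).
by split; [apply: B_eq_projective|apply: B_eq_injective].
Qed.
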